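(* Let $\Omega\subset\mathbb{R}^2$ be one of the two types of domains below and let $\omega(t)\in L^1(\Omega)$, $t\ge0$, be a global weak solution to the 2D Euler equation in vorticity form on $\Omega$ (in the sense of the context), with a nonnegative initial data $\omega_{in}\in L^1(\Omega)$. (Radial steady states.) Assume $\Omega=B(0,R)$ is the disc centered at $0$ of radius $R\in(0,+\infty]$ ($\Omega=\mathbb{R}^2$ if $R=+\infty$). Let $q\in L^1\cap L^\infty(\Omega)$ be of the form $q(x)=G(|x|)$, where $G$ is a nonnegative decreasing (i.e. nonincreasing) function such that $\int_\Omega|x|^2G(|x|)\,dx<+\infty$. Then for all $t\ge0$, $$\Big(\|\omega(t)-q\|_{L^1(\Omega)}+\|q\|_{L^1}-\|\omega_{in}\|_{L^1}\Big)^2\le4\pi\|q\|_{L^\infty}\left[\int_\Omega|x|^2(\omega_{in}(x)-q(x))\,dx+\frac2\pi\int_0^{+\infty}\mu_q(s)\,\beta_{\omega_{in}^*,q^*}(s)\,ds\right].$$ In particular, if $q$ is compactly supported then $$\Big(\|\omega(t)-q\|_{L^1(\Omega)}+\|q\|_{L^1}-\|\omega_{in}\|_{L^1}\Big)^2\le4\pi\|q\|_{L^\infty}\left[\int_\Omega|x|^2(\omega_{in}(x)-q(x))\,dx+\frac2\pi\,\mathrm{meas}(\mathrm{Supp}(q))\,\|\omega_{in}^*-q^*\|_{L^1(\Omega)}\right].$$ (Steady states on a rectangular domain.) Assume $\Omega=\,]0,L_1[\,\times\,]0,L_2[$ with $L_1\in(0,+\infty)$ and $L_2\in(0,+\infty]$.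 Let $q\in L^1\cap L^\infty(\Omega)$ be of the form $q(x)=F(x_2)$, where $F$ is a nonnegative decreasing (i.e. nonincreasing) function such that $\int_0^{L_2}x_2F(x_2)\,dx_2<+\infty$. Then for all $t\ge0$, $$\Big(\|\omega(t)-q\|_{L^1}+\|q\|_{L^1}-\|\omega_{in}\|_{L^1}\Big)^2\le4L_1^{\gamma}\|q\|_{L^\infty}\left[\int_\Omega x_2(\omega_{in}(x)-q(x))\,dx+\frac2{L_1}\int_0^{+\infty}\mu_q(s)\,\beta_{\omega_{in}^*,q^*}(s)\,ds\right]\quad\text{with }\gamma=1.$$ In particular, if $q$ is compactly supported then $$\Big(\|\omega(t)-q\|_{L^1}+\|q\|_{L^1}-\|\omega_{in}\|_{L^1}\Big)^2\le4L_1\|q\|_{L^\infty}\left[\int_\Omega x_2(\omega_{in}(x)-q(x))\,dx+\frac2{L_1}\,\mathrm{meas}(\mathrm{Supp}(q))\,\|\omega_{in}^*-q^*\|_{L^1}\right].$$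
   Context: The 2D Euler equation in vorticity form is $\partial_t\omega+\nabla^\perp\psi\cdot\nabla\omega=0$ on $\mathbb{R}_+\times\Omega$, $-\Delta\psi=\omega$ on $\Omega$, $\omega(0,x)=\omega_{in}(x)$, with the following boundary conditions. On $B(0,R)$, $R<\infty$: $\psi=0$ on $\partial\Omega$; on $\mathbb{R}^2$: $\psi(x)=-\frac1{2\pi}\int_{\mathbb{R}^2}\ln(|x-y|)\,\omega(y)\,dy$. On $]0,L_1[\times]0,L_2[$: $\psi(0,x_2)=\psi(L_1,x_2)$ for $x_2\in[0,L_2]$ (periodicity in $x_1$), $\psi(x_1,0)=0$ and $\psi(x_1,L_2)=0$ for $x_1\in[0,L_1]$, the latter being replaced by $\lim_{x_2\to+\infty}\psi(x_1,x_2)=0$ if $L_2=+\infty$. The functions $q$ in the claim are steady states of this system. Global weak solutions $\omega(t)\in L^1(\Omega)$ with nonnegative initial data are nonnegative solutions in the sense of distributions which, as is known for this flow, preserve the rearrangement, $\omega(t)^*=\omega_{in}^*$ for all $t\ge0$, and preserve (in $[0,+\infty]$) the momentum: $\int_\Omega|x|^2\omega(t,x)\,dx=\int_\Omega|x|^2\omega_{in}(x)\,dx$ when $\Omega=B(0,R)$, and $\int_\Omega x_2\,\omega(t,x)\,dx=\int_\Omega x_2\,\omega_{in}(x)\,dx$ when $\Omega=\,]0,L_1[\times]0,L_2[$. For nonnegative $g\in L^1(\Omega)$: $\mu_g(s)=\mathrm{meas}\{x\in\Omega:\ g(x)>s\}$ for $s\ge0$, $g^\sharp(r)=\inf\{t\ge0:\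 \mu_g(t)\le r\}$ for $r\ge0$, and the rearrangement of $g$ on $\Omega$ is $g^*(x)=g^\sharp(\mathrm{meas}(B_2(0,|x|)\cap\Omega))$, where $B_2(0,r)$ is the disc of $\mathbb{R}^2$ centered at $0$ with radius $r$. For nonnegative $g,h\in L^1(\Omega)$: $\beta_{g,h}(s)=\mathrm{meas}\{x\in\Omega:\ g(x)\le s<h(x)\}$. $\mathrm{Supp}(q)$ is the support of $q$ and $\mathrm{meas}$ is Lebesgue measure. *)

(* Defs.v *)
From mathcomp Require Import all_boot all_order all_algebra.
From mathcomp Require Import all_classical all_reals all_analysis.
Set Implicit Arguments.
Unset Strict Implicit.
Unset Printing Implicit Defensive.
Import Order.TTheory GRing.Theory Num.Theory.
Import numFieldNormedType.Exports.
Local Open Scope classical_set_scope.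
Local Open Scope ring_scope.

Notation leb2 := (lebesgue_measure \x lebesgue_measure)%E.
Notation leb3 := (lebesgue_measure \x leb2)%E.

Definition enorm {R : realType} (x : R * R) : R :=
  Num.sqrt (x.1 ^+ 2 + x.2 ^+ 2).

(* rad = +oo gives the whole plane *)
Definition disc {R : realType} (rad : \bar R) : set (R * R) :=
  [set x | ((enorm x)%:E < rad)%E].

Definition rect {R : realType} (L1 : R) (L2 : \bar R) : set (R * R) :=
  [set x | [/\ 0 < x.1, x.1 < L1, 0 < x.2 & (x.2%:E < L2)%E]].

Definition inL1 {R : realType} (Omega : set (R * R)) (f : R * R -> R) : Prop :=
  leb2.-integrable Omega (EFin \o f).

(* f \_ Omega is the extension of f by zero, so this is the norm of
   L^p(Omega). *)
Definition norm_on {R : realType} (Omega : set (R * R)) (p : \bar R)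
    (f : R * R -> \bar R) : \bar R :=
  Lnorm leb2 p (f \_ Omega).

Definition distr_fun {R : realType} (Omega : set (R * R))
    (g : R * R -> \bar R) (s : R) : \bar R :=
  leb2 (Omega `&` [set x | (s%:E < g x)%E]).

(* The rearrangement is extended-real valued: g^#(0) = +oo when g is not
   essentially bounded. *)
Definition decr_rearr {R : realType} (Omega : set (R * R))
    (g : R * R -> \bar R) (r : \bar R) : \bar R :=
  ereal_inf [set t%:E | t in [set t : R | 0 <= t /\ (distr_fun Omega g t <= r)%E]].

Definition rearr {R : realType} (Omega : set (R * R))
    (g : R * R -> \bar R) (x : R * R) : \bar R :=
  decr_rearr Omega g (leb2 (disc (enorm x)%:E `&` Omega)).

Definition beta {R : realType} (Omega : set (R * R))
    (g h : R * R -> \bar R) (s : R) : \bar R :=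
  leb2 (Omega `&` [set x | (g x <= s%:E)%E /\ (s%:E < h x)%E]).

(* The support is closed in the plane, not in Omega: with closedness in Omega,
   no nonzero function of x.2 on a rectangle would be compactly supported. *)
Definition Supp {R : realType} (Omega : set (R * R)) (q : R * R -> R) :
    set (R * R) :=
  closure [set x | Omega x /\ q x != 0].

Fixpoint iter_derive {R : realType} {V : normedModType R} (vs : seq V)
    (f : V -> R) : V -> R :=
  if vs is v :: vs' then 'D_v (iter_derive vs' f) else f.

Definition smooth {R : realType} {V : normedModType R} (f : V -> R) : Prop :=
  forall vs : seq V, continuous (iter_derive vs f) /\
    forall x v, derivable (iter_derive vs f) x v.

(* Restrictions to D of the elements of C_c^oo(V) supported in D. *)
Definition test_fun {R : realType} {V : normedModType R} (D : set V)
    (f : V -> R) : Prop :=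
  smooth f /\
  exists K : set V, [/\ compact K, K `<=` D & forall x, ~ K x -> f x = 0].

Definition periodic_test_fun {R : realType} (L1 : R) (f : R * R -> R) : Prop :=
  [/\ smooth f, forall x, f (x.1 + L1, x.2) = f x
    & exists M, forall x, M < `|x.2| -> f x = 0].

Notation "'\d1' f" := ('D_(1, 0) f) (at level 10, f at next level).
Notation "'\d2' f" := ('D_(0, 1) f) (at level 10, f at next level).

(* Green's formula without boundary term, v being the gradient of psi. *)
Definition green_formula {R : realType} (Omega : set (R * R))
    (psi : R * R -> R) (v : R * R -> R * R) (chi : R * R -> R) : Prop :=
  (\int[leb2]_(x in Omega) (psi x * \d1 chi x)%:E =
   - \int[leb2]_(x in Omega) ((v x).1 * chi x)%:E)%E /\
  (\int[leb2]_(x in Omega) (psi x * \d2 chi x)%:E =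
   - \int[leb2]_(x in Omega) ((v x).2 * chi x)%:E)%E.

(* psi is W^{1,1} on bounded parts of Omega, with weak gradient v, and
   - Delta psi = om in the sense of distributions on Omega. *)
Definition poisson {R : realType} (Omega : set (R * R)) (om : R * R -> R)
    (psi : R * R -> R) (v : R * R -> R * R) : Prop :=
  [/\ forall K, compact K ->
        [/\ inL1 (Omega `&` K) psi,
            inL1 (Omega `&` K) (fun x => (v x).1)
          & inL1 (Omega `&` K) (fun x => (v x).2)],
      forall chi, test_fun Omega chi -> green_formula Omega psi v chi
    & forall chi, test_fun Omega chi ->
        (- (\int[leb2]_(x in Omega)
              (psi x * (\d1 (\d1 chi) x + \d2 (\d2 chi) x))%:E) =
         \int[leb2]_(x in Omega) (om x * chi x)%:E)%E].

(* For finite rad: psi = 0 on the circle in the sense of traces, i.e. Green's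
   formula has no boundary term for test functions that need not vanish near
   the circle. For rad = +oo: psi is the logarithmic potential of om. *)
Definition disc_bc {R : realType} (rad : \bar R) (om : R * R -> R)
    (psi : R * R -> R) (v : R * R -> R * R) : Prop :=
  if rad == +oo%E then
    {ae leb2, forall x : R * R, ((psi x)%:E = (- (2 * pi)^-1)%:E *
      \int[leb2]_y (ln (enorm (x.1 - y.1, x.2 - y.2)) * om y)%:E)%E}
  else forall chi, test_fun setT chi -> green_formula (disc rad) psi v chi.

(* Against L1-periodic test functions, the boundary term of Green's formula is
   the jump of psi between x.1 = 0 and x.1 = L1, plus the traces of psi on
   x.2 = 0 and (for finite L2) on x.2 = L2. *)
Definition rect_bc {R : realType} (L1 : R) (L2 : \bar R) (om : R * R -> R)
    (psi : R * R -> R) (v : R * R -> R * R) : Prop :=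
  (forall chi, periodic_test_fun L1 chi ->
     green_formula (rect L1 L2) psi v chi) /\
  (L2 = +oo%E -> forall x1, 0 <= x1 <= L1 ->
     psi (x1, x2) @[x2 --> +oo] --> (0 : R)).

Definition loc_integrable {R : realType} (D : set (R * (R * R)))
    (f : R * (R * R) -> R) : Prop :=
  forall K, compact K -> K `<=` D -> leb3.-integrable K (EFin \o f).

(* d_t om + div (om nabla^perp psi) = 0 on [0, +oo[ x Omega in the sense of
   distributions, with initial value om_in. Here v = nabla psi and
   nabla^perp = (d_2, - d_1), so that the velocity has curl - Delta psi. Test
   functions need not vanish at time 0. *)
Definition transport {R : realType} (Omega : set (R * R)) (om_in : R * R -> R)
    (om : R -> R * R -> R) (v : R -> R * R -> R * R) : Prop :=
  let D := [set z : R * (R * R) | 0 <= z.1 /\ Omega z.2] in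
  [/\ loc_integrable D (fun z => om z.1 z.2),
      loc_integrable D (fun z => om z.1 z.2 * (v z.1 z.2).1),
      loc_integrable D (fun z => om z.1 z.2 * (v z.1 z.2).2)
    & forall phi : R * (R * R) -> R, test_fun (setT `*` Omega) phi ->
        (\int[leb3]_(z in D)
           (om z.1 z.2 * ('D_(1, (0, 0)) phi z
              + (v z.1 z.2).2 * 'D_(0, (1, 0)) phi z
              - (v z.1 z.2).1 * 'D_(0, (0, 1)) phi z))%:E
         + \int[leb2]_(x in Omega) (om_in x * phi (0, x))%:E = 0)%E].

(* bc om psi v is the boundary condition of the stream function, and weight the
   density of the conserved momentum. *)
Record global_weak_solution {R : realType} (Omega : set (R * R))
    (bc : (R * R -> R) -> (R * R -> R) -> (R * R -> R * R) -> Prop)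
    (weight : R * R -> R) (om_in : R * R -> R) (om : R -> R * R -> R) : Prop := {
  sol_L1 : forall t, 0 <= t -> inL1 Omega (om t) ;
  sol_ge0 : forall t, 0 <= t ->
    {ae leb2, forall x, Omega x -> 0 <= om t x} ;
  sol_init : {ae leb2, forall x, Omega x -> om 0 x = om_in x} ;
  sol_euler : exists (psi : R -> R * R -> R) (v : R -> R * R -> R * R),
    {ae lebesgue_measure, forall t : R, 0 <= t ->
      poisson Omega (om t) (psi t) (v t) /\ bc (om t) (psi t) (v t)} /\
    transport Omega om_in om v ;
  sol_rearr : forall t, 0 <= t -> forall x, Omega x ->
    rearr Omega (EFin \o om t) x = rearr Omega (EFin \o om_in) x ;
  sol_momentum : forall t, 0 <= t ->
    (\int[leb2]_(x in Omega) (weight x * om t x)%:E =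
     \int[leb2]_(x in Omega) (weight x * om_in x)%:E)%E
}.

Definition euler_disc {R : realType} (rad : \bar R) (om_in : R * R -> R)
    (om : R -> R * R -> R) : Prop :=
  global_weak_solution (disc rad) (disc_bc rad) (fun x => enorm x ^+ 2) om_in om.

Definition euler_rect {R : realType} (L1 : R) (L2 : \bar R)
    (om_in : R * R -> R) (om : R -> R * R -> R) : Prop :=
  global_weak_solution (rect L1 L2) (rect_bc L1 L2) (fun x => x.2) om_in om.

(* Main.v *)
(* For f, q >= 0, ||f - q|| + ||q|| - ||f|| = 2 int (q - f)^+, and layer by layer
   int (q - f)^+ = int_0^oo |B \ A| ds with A = {f > s} and B = {q > s}. By
   Cauchy-Schwarz the square of this is at most ||q||_oo int_0^oo |B \ A|^2 ds.
   The conserved weight is a multiple of a coordinate w whose sublevel sets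
   {w < r} have measure r (pi |x|^2 on a disc, L1 x.2 on a rectangle), and q is
   a nonincreasing function of w, so B is a sublevel set of w. Moving A \ B and
   B \ A along w next to the boundary of B gives, for each s > 0,
     |B \ A|^2 <= int_(A \ B) w - int_(B \ A) w + 2 |B| (|B| - |A|)^+,
   and integrating over s turns the right-hand side into
   int w (f - q) + 2 int mu_q (mu_q - mu_f)^+. Finally mu_f is determined by the
   rearrangement of f, which is preserved by the flow, as is int w f. *)
Require Import Defs.
From HB Require Import structures.
From mathcomp Require Import all_boot all_order all_algebra.
From mathcomp Require Import all_classical all_reals all_analysis.
From mathcomp Require Import measurable_realfun ess_sup_inf ring lra.
Import Order.TTheory GRing.Theory Num.Theory.
Import numFieldNormedType.Exports.
Set Implicit Arguments.
Unset Strict Implicit.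
Unset Printing Implicit Defensive.
Local Open Scope classical_set_scope.
Local Open Scope ring_scope.

(** * Layer decomposition of integrals *)

(** Origin of the factor 2 in the correction term: write al = |A \ B| and be = |B \ A|. The moved
    sets give the lower bound |B| (al - be) + (al^2 + be^2)/2. If |A| < |B|, the linear term is -
    |B| (|B| - |A|). One copy of |B| (|B| - |A|) cancels it, and the second covers the missing
    quadratic part (be^2 - al^2)/2 = (|B| - |A|) (be + al)/2, because al < be <= |B|. The momentum
    of f may be infinite. Identities are therefore first written between sums of nonnegative
    extended integrals, and only terms known to be finite, such as int w q or int w (q - f)^+, are
    moved across. That mu_f is determined by f^* is not immediate, since a rectangle meets the discs
    centred at 0 in no simple area. It is enough that t |-> |Omega & {pi |x|^2 < t}| is
    nondecreasing and 1-Lipschitz, so that it attains every value between 0 and |Omega|, the latter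
    possibly in the limit. *)

Lemma measurable_layers (d : measure_display) (T : measurableType d)
    (R : realType) (D : set T) (g h : T -> \bar R) : measurable D ->
  measurable_fun D g -> measurable_fun D h ->
  measurable [set z : T * R | [/\ D z.1, 0 <= z.2, (g z.1 <= z.2%:E)%E
                               & (z.2%:E < h z.1)%E]].
Proof.
move=> mD mg mh.
have mgD : measurable_fun [set: T] (g \_ D) by apply/(measurable_restrictT _ mD).
have mhD : measurable_fun [set: T] (h \_ D) by apply/(measurable_restrictT _ mD).
have m2 : measurable_fun [set: T * R] (fun z : T * R => z.2%:E).
  by apply/measurable_EFinP; exact: measurable_snd.
have mle : measurable [set z : T * R | ((g \_ D) z.1 <= z.2%:E)%E].
  rewrite -[X in measurable X]setTI; apply: measurable_lee => //.
  exact: measurableT_comp.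
have mge : measurable [set z : T * R | ((h \_ D) z.1 <= z.2%:E)%E].
  rewrite -[X in measurable X]setTI; apply: measurable_lee => //.
  exact: measurableT_comp.
rewrite (_ : mkset _ = (D `*` `[0, +oo[) `&`
  ([set z | ((g \_ D) z.1 <= z.2%:E)%E] `\`
   [set z | ((h \_ D) z.1 <= z.2%:E)%E])).
  apply: measurableI; last exact: measurableD.
  exact: measurableX.
apply/seteqP; split => [[x s]/= [Dx s0 gs sh]|[x s]/= [[Dx]]].
  rewrite !patchE mem_set// in_itv/= s0 gs; repeat split => //.
  by apply/negP; rewrite -ltNge.
rewrite in_itv/= andbT !patchE mem_set// => s0 [gs /negP]; rewrite -ltNge.
by move=> sh; split.
Qed.

Lemma measurable_layer (d : measure_display) (T : measurableType d)
    (R : realType) (D : set T) (g h : T -> \bar R) (s : R) : measurable D ->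
  measurable_fun D g -> measurable_fun D h ->
  measurable (D `&` [set x | (g x <= s%:E < h x)%E]).
Proof.
move=> mD mg mh.
rewrite (_ : _ `&` _ = (D `&` [set x | (g x <= s%:E)%E]) `&`
                       (D `&` [set x | (s%:E < h x)%E])); last first.
  apply/seteqP; split => [x/= [Dx /andP[]]//|x/= [[Dx gs] [_ sh]]].
  by rewrite gs sh.
apply: measurableI.
  exact: emeasurable_fun_infty_c.
exact: emeasurable_fun_o_infty.
Qed.

(** Tonelli on the region between the graphs of [g] and [h], with density [w]: its slices at height
    s are the layers, its fibres over x are intervals. The weight 1 gives measures of layers, a
    coordinate gives their moments. Values in [\bar R] are allowed because a rearrangement may be
    infinite at a point. *)
Lemma fubini_layers (d : measure_display) (T : measurableType d) (R : realType)
    (mu : {sigma_finite_measure set T -> \bar R}) (D : set T) (w : T -> R)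
    (g h : T -> \bar R) : measurable D ->
  measurable_fun D w -> (forall x, D x -> 0 <= w x) ->
  measurable_fun D g -> measurable_fun D h ->
  measurable_fun (`[0, +oo[ : set R) (fun s : R =>
    \int[mu]_(x in D `&` [set x | (g x <= s%:E < h x)%E]) (w x)%:E)%E /\
  (\int[lebesgue_measure]_(s in `[0%R, +oo[)
     \int[mu]_(x in D `&` [set x | (g x <= s%:E < h x)%E]) (w x)%:E =
   \int[mu]_(x in D) ((w x)%:E *
     lebesgue_measure [set s : R | [/\ (0 <= s)%R, (g x <= s%:E)%E
                                     & (s%:E < h x)%E]]))%E.
Proof.
move=> mD mw w0 mg mh.
have mA := measurable_layers mD mg mh; set A := mkset _ in mA.
pose F (z : T * R) : \bar R := (((w \_ D) z.1) * (\1_A z))%:E.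
have mF : measurable_fun [set: T * R] F.
  apply/measurable_EFinP; apply: measurable_funM.
    apply: measurableT_comp => //; first exact/(measurable_restrictT _ mD).
  exact: measurable_indic.
have F0 z : (0 <= F z)%E.
  rewrite lee_fin mulr_ge0// patchE; case: ifPn => // /set_mem; exact: w0.
have inner s : 0 <= s -> (\int[mu]_x F (x, s) =
    \int[mu]_(x in D `&` [set x | (g x <= s%:E < h x)%E]) (w x)%:E)%E.
  move=> s0; rewrite [RHS]integral_mkcond; apply: eq_integral => x _.
  rewrite /F /= !patchE indicE.
  have [Dx|Dx] := boolP (x \in D); last first.
    rewrite mul0r; case: ifPn => // /set_mem [Dx'].
    by move: Dx; rewrite mem_set.
  case: ifPn => [/set_mem[_ /= /andP[gs sh]]|xN].
    by rewrite mem_set ?mulr1//; split => //; exact/set_mem.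
  rewrite memNset ?mulr0// => -[/= Dx' _ gs sh].
  by move/negP: xN; apply; rewrite mem_set//; split => //=; rewrite gs.
have out s : s < 0 -> (\int[mu]_x F (x, s) = 0)%E.
  move=> s0; apply: integral0_eq => x _; rewrite /F /= indicE memNset ?mulr0//.
  by move=> [_ /=]; rewrite leNgt s0.
have mG := measurable_fun_fubini_tonelli_G (m1 := mu) F mF F0.
split.
  apply: (eq_measurable_fun (fubini_G mu F)).
    by move=> s /set_mem; rewrite /= in_itv/= andbT => s0; rewrite -inner.
  exact: measurable_funTS.
transitivity (\int[lebesgue_measure]_s \int[mu]_x F (x, s))%E.
  rewrite integral_mkcond; apply: eq_integral => s _; rewrite patchE.
  case: ifPn => [/set_mem/=|/negP sN].
    by rewrite in_itv/= andbT => s0; rewrite inner.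
  rewrite out// ltNge; apply/negP => s0; apply: sN.
  by rewrite mem_set//= in_itv/= s0.
rewrite -(fubini_tonelli (m1 := mu) (m2 := lebesgue_measure) F)//.
rewrite [RHS]integral_mkcond; apply: eq_integral => x _.
rewrite /F/= !patchE; case: ifPn => [/set_mem Dx|Dx]; last first.
  by rewrite integral0_eq// => s _; rewrite mul0r.
have secE : (fun s : R => \1_A (x, s) : R) = \1_(xsection A x).
  by apply/funext => s; rewrite !indicE mem_xsection.
have mx := measurable_xsection x mA.
under eq_integral do rewrite EFinM.
rewrite ge0_integralZl_EFin//; last 2 first.
- by apply/measurable_EFinP; rewrite secE; exact: measurable_indic.
- exact: w0.
congr (_ * _)%E.
transitivity (\int[lebesgue_measure]_s (\1_(xsection A x) s)%:E)%E.
  by apply: eq_integral => s _; rewrite -secE.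
rewrite integral_indic// setIT; congr (lebesgue_measure _).
apply/seteqP; split => s /=; first by rewrite /xsection/= => /set_mem [].
by move=> [s0 gs sh]; rewrite /xsection /=; apply/mem_set; split.
Qed.

Lemma lebesgue_measure_layer (R : realType) (a b : R) : 0 <= a ->
  lebesgue_measure [set s : R | [/\ 0 <= s, (a%:E <= s%:E)%E & (s%:E < b%:E)%E]]
  = (Num.max 0 (b - a))%:E.
Proof.
move=> a0; rewrite (_ : mkset _ = `[a, b[%classic); last first.
  apply/seteqP; split => [s/= [_]|s/=]; rewrite in_itv/= !lee_fin lte_fin.
    by move=> -> ->.
  by move=> /andP[as_ sb]; split=> //; exact: le_trans as_.
rewrite lebesgue_measure_itv/= lte_fin; case: ltP => ab.
  by rewrite -EFinB max_r// subr_ge0 ltW.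
by rewrite max_l// subr_le0.
Qed.

Lemma integral_affine_triangle (R : realType) (a : R) : 0 <= a ->
  (\int[lebesgue_measure]_(s in `[0%R, a]) (a - s)%:E = (a ^+ 2 / 2)%:E)%E.
Proof.
rewrite le_eqVlt => /predU1P[<-|a0].
  by rewrite set_itv1 integral_set1 expr0n mul0r.
pose F (s : R) := a * s - s ^+ 2 / 2.
have dF (s : R) : is_derive s 1 F (a - s).
  rewrite /F; apply: is_derive_eq.
  by rewrite /GRing.scale/= !mulr0 !mulr1 add0r; lra.
have cf : continuous (fun s : R => a - s).
  by move=> s; apply: cvgB; [exact: cvg_cst|exact: cvg_id].
have cF s : {for s, continuous F}.
  by apply: differentiable_continuous; apply/derivable1_diffP; exact: ex_derive.
rewrite (@continuous_FTC2 _ (fun s => a - s) F)//.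
- by rewrite -EFinB; congr EFin; rewrite /F; lra.
- exact: continuous_subspaceT.
- split => //.
  + by apply: cvg_at_right_filter; exact: cF.
  + by apply: cvg_at_left_filter; exact: cF.
- by move=> s _; rewrite derive1E derive_val.
Qed.

(* The integral of v over a set of measure a is least when v equidistributes its
   values over [0, a]. *)
Lemma bathtub (d : measure_display) (T : measurableType d) (R : realType)
    (mu : {sigma_finite_measure set T -> \bar R}) (E : set T) (v : T -> R)
    (a : R) : measurable E -> measurable_fun E v ->
  (forall x, E x -> 0 <= v x) -> mu E = a%:E ->
  (forall u, 0 < u -> (mu (E `&` [set x | v x < u]%R) <= u%:E)%E) ->
  ((a ^+ 2 / 2)%:E <= \int[mu]_(x in E) (v x)%:E)%E.
Proof.
move=> mE mv v0 muE vu.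
have a0 : 0 <= a by rewrite -lee_fin -muE measure_ge0.
have mev : measurable_fun E (EFin \o v) by exact/measurable_EFinP.
(* The hypothesis concerns strict sublevel sets at positive heights; the closed one at u lies in the
   strict one at u + e, which also covers u = 0. *)
have le_u u : 0 <= u -> (mu (E `&` [set x | (v x)%:E <= u%:E]) <= u%:E)%E.
  move=> u0; apply/lee_addgt0Pr => e e0; rewrite -EFinD.
  apply: le_trans (vu (u + e) _); last exact: ltr_wpDl.
  apply: le_measure; rewrite ?inE.
  - exact: emeasurable_fun_infty_c.
  - exact: emeasurable_fun_infty_o mE mev (u + e)%:E.
  - move=> x [Ex] /=; rewrite lee_fin => vxu; split => //=.
    by rewrite (le_lt_trans vxu)// ltrDl.
have gt_u u : 0 <= u -> ((a - u)%:E <=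
    \int[mu]_(x in E `&` [set x | (0 <= u%:E < (v x)%:E)%E]) (1 : R)%:E)%E.
  move=> u0; rewrite integral_cst ?mul1e; last first.
    exact: (measurable_layer (g := cst 0%E)).
  rewrite EFinB leeBlDr// -muE.
  rewrite (measureDI mu mE (emeasurable_fun_infty_c mE mev u%:E)).
  apply: leeD; last by rewrite setIA setIid; exact: le_u.
  apply: le_measure; rewrite ?inE.
  - by apply: measurableD => //; exact: emeasurable_fun_infty_c.
  - exact: (measurable_layer (g := cst 0%E)).
  - move=> x [Ex /= vx]; split => //=; rewrite lee_fin u0/= ltNge.
    by apply/negP => vxu; apply: vx.
have [m1 ] := fubini_layers (w := cst (1 : R)) (g := cst 0%E) (h := EFin \o v)
  mu mE (@measurable_cst _ _ _ _ _ _) (fun _ _ => ler01)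
  (@measurable_cst _ _ _ _ _ _) mev.
rewrite [in X in _ = X -> _](eq_integral (fun x => (v x)%:E)); last first.
  move=> x /set_mem Ex; rewrite mul1e lebesgue_measure_layer// subr0 max_r//.
  exact: v0.
(* The layer-cake integral of mu {v > u} is cut down to [0, a], where [gt_u] bounds the integrand
   below by a - u. *)
move=> <-; rewrite -integral_affine_triangle//.
apply: le_trans (ge0_subset_integral lebesgue_measure (A := `[0, a]) _ _ m1 _ _).
- apply: ge0_le_integral => //.
  + by move=> s; rewrite /= in_itv/= lee_fin subr_ge0 => /andP[].
  + by apply/measurable_EFinP; apply: measurable_funB.
  + by apply: measurable_funS m1 => //; apply: subset_itvl.
  + by move=> s; rewrite /= in_itv/= => /andP[s0 _]; exact: gt_u.
- exact: measurable_itv.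
- exact: measurable_itv.
- by move=> s _; apply: integral_ge0.
- exact: subset_itvl.
Qed.

(** * Coordinates measuring the volume of their sublevel sets *)

(* w is a coordinate on D that measures the volume of its own sublevel sets:
   pi |x|^2 on a disc, L1 x.2 on a rectangle. *)
Definition volume_coordinate (d : measure_display) (T : measurableType d)
    (R : realType) (mu : set T -> \bar R) (D : set T) (w : T -> R) : Prop :=
  [/\ measurable_fun D w, forall x, D x -> 0 <= w x,
      forall x, D x -> ((w x)%:E <= mu D)%E
    & forall r : R, 0 <= r -> (r%:E <= mu D)%E ->
        mu (D `&` [set x | w x < r]) = r%:E].

(** The boundary value of [w] is b = mu B: [w] is at least b on D \ B and at most b on B. Hence
    [bathtub] applies to w - b on A \ B and to b - w on B \ A. *)
Lemma layer_estimate (d : measure_display) (T : measurableType d)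
    (R : realType) (mu : {sigma_finite_measure set T -> \bar R})
    (D A B : set T) (w : T -> R) :
  measurable D -> measurable A -> measurable B -> A `<=` D -> B `<=` D ->
  volume_coordinate mu D w ->
  (forall x y, D x -> D y -> w x <= w y -> B y -> B x) ->
  (mu A < +oo)%E -> (mu B < +oo)%E ->
  ((fine (mu (B `\` A)) ^+ 2)%:E + \int[mu]_(x in B `\` A) (w x)%:E <=
   \int[mu]_(x in A `\` B) (w x)%:E +
   (2 * fine (mu B) * Num.max 0 (fine (mu B) - fine (mu A)))%:E)%E.
Proof.
move=> mD mA mB AD BD [mw w0 wD muw] Bdown Afin Bfin.
have finm (X : set T) : (mu X < +oo)%E -> mu X = (fine (mu X))%:E.
  by move=> Xfin; rewrite fineK// ge0_fin_numE.
have mlt (X : set T) (v : T -> R) r : measurable X -> measurable_fun X v ->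
    measurable (X `&` [set x | v x < r]).
  move=> mX /measurable_EFinP mv.
  by have := emeasurable_fun_infty_o mX mv r%:E; under eq_set do rewrite lte_fin.
have muw_le r : 0 <= r -> (mu (D `&` [set x | w x < r]%R) <= r%:E)%E.
  move=> r0; have [rD|Dr] := leP r%:E (mu D); first by rewrite muw.
  apply: le_trans (ltW Dr); apply: le_measure; rewrite ?inE//; exact: mlt.
have mAB : measurable (A `\` B) by exact: measurableD.
have mBA : measurable (B `\` A) by exact: measurableD.
have mAIB : measurable (A `&` B) by exact: measurableI.
have ABfin : (mu (A `\` B) < +oo)%E.
  by apply: le_lt_trans Afin; apply: le_measure; rewrite ?inE//; exact: subDsetl.
have BAfin : (mu (B `\` A) < +oo)%E.
  by apply: le_lt_trans Bfin; apply: le_measure; rewrite ?inE//; exact: subDsetl.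
have AIBfin : (mu (A `&` B) < +oo)%E.
  by apply: le_lt_trans Afin; apply: le_measure; rewrite ?inE//; exact: subIsetl.
set a := fine (mu A); set b := fine (mu B).
set al := fine (mu (A `\` B)); set be := fine (mu (B `\` A)).
pose c := fine (mu (A `&` B)).
have aE : a = al + c.
  by apply: EFin_inj; rewrite EFinD /a /al /c -!finm//; exact: measureDI.
have bE : b = be + c.
  apply: EFin_inj; rewrite EFinD /b /be /c -!finm// setIC; exact: measureDI.
have c0 : 0 <= c by exact/fine_ge0/measure_ge0.
have al0 : 0 <= al by exact/fine_ge0/measure_ge0.
have be0 : 0 <= be by exact/fine_ge0/measure_ge0.
have b0 : 0 <= b by exact/fine_ge0/measure_ge0.
have muB : mu B = b%:E by exact: finm.
(* B is contained in {w < w x} when x is outside B; dually, in [le_b], {w < w x} is contained in B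
   when x is in B. *)
have b_le x : D x -> ~ B x -> b <= w x.
  move=> Dx NBx; rewrite -lee_fin -muB; apply: le_trans (muw_le _ (w0 _ Dx)).
  apply: le_measure; rewrite ?inE//; first exact: mlt.
  move=> y By /=; split; first exact: BD.
  by rewrite ltNge; apply/negP => wxy; apply: NBx; exact: (Bdown x y Dx (BD _ By) wxy By).
have le_b x : B x -> w x <= b.
  move=> Bx; have Dx := BD _ Bx; rewrite -lee_fin -muB -(muw _ (w0 _ Dx) (wD _ Dx)).
  apply: le_measure; rewrite ?inE//; first exact: mlt.
  by move=> y [Dy /= /ltW wyx]; exact: (Bdown y x Dy Dx wyx Bx).
have mwAB : measurable_fun (A `\` B) w.
  by apply: measurable_funS mw => // x [/AD].
have mwBA : measurable_fun (B `\` A) w.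
  by apply: measurable_funS mw => // x [/BD].
have P_ge : ((b * al + al ^+ 2 / 2)%:E <= \int[mu]_(x in A `\` B) (w x)%:E)%E.
  have mv : measurable_fun (A `\` B) (fun x => w x - b).
    exact: measurable_funB.
  have v0 x : (A `\` B) x -> 0 <= w x - b.
    by move=> [/AD Dx NBx]; rewrite subr_ge0; exact: b_le.
  have -> : (\int[mu]_(x in A `\` B) (w x)%:E =
      \int[mu]_(x in A `\` B) (cst b%:E x + (w x - b)%:E))%E.
    by apply: eq_integral => x _; rewrite -EFinD /= addrC subrK.
  rewrite ge0_integralD//; last exact/measurable_EFinP.
  have -> : (\int[mu]_(x in A `\` B) cst b%:E x = (b * al)%:E)%E.
    transitivity (b%:E * mu (A `\` B))%E; first exact: integral_cst.
    by rewrite finm.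
  rewrite EFinD leeD2l//.
  apply: bathtub => //; first exact: finm.
  (* B and the part of A \ B where w < b + u are disjoint subsets of {w < b + u}, whose measure is
     at most b + u; this leaves at most u for that part. *)
  move=> u u0; rewrite -(@leeD2lE _ b%:E)// -EFinD -muB.
  have muD : (mu (D `&` [set x | (w x < b + u)%R]) <= (b + u)%:E)%E.
    by apply: muw_le; rewrite addr_ge0// ltW.
  apply: le_trans muD; rewrite -measureU//.
  - apply: le_measure; rewrite ?inE//.
    + by apply: measurableU => //; exact: mlt.
    + exact: mlt.
    + move=> x [Bx|[[Ax _]/=]]; split => //=.
      * exact: BD.
      * by rewrite (le_lt_trans (le_b _ Bx))// ltrDl.
      * exact: AD.
      * by rewrite addrC -ltrBlDr.
  - exact: mlt.
  - by apply/seteqP; split => // x [Bx [[_ NBx] _]].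
have N_le : (\int[mu]_(x in B `\` A) (w x)%:E + (be ^+ 2 / 2)%:E <=
    (b * be)%:E)%E.
  have mv : measurable_fun (B `\` A) (fun x => b - w x).
    exact: measurable_funB.
  have v0 x : (B `\` A) x -> 0 <= b - w x.
    by move=> [Bx _]; rewrite subr_ge0; exact: le_b.
  have -> : ((b * be)%:E = \int[mu]_(x in B `\` A) (w x)%:E +
      \int[mu]_(x in B `\` A) (b - w x)%:E)%E.
    have -> : ((b * be)%:E = \int[mu]_(x in B `\` A) cst b%:E x)%E.
      transitivity (b%:E * mu (B `\` A))%E; first by rewrite finm.
      by rewrite integral_cst.
    rewrite -ge0_integralD//.
    - by apply: eq_integral => x _; rewrite /= -EFinD addrC subrK.
    - by move=> x [/BD/w0].
    - exact/measurable_EFinP.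
    - exact/measurable_EFinP.
  rewrite leeD2l//; apply: bathtub => //; first exact: finm.
  (* For u <= b, the part of B \ A where w > b - u is disjoint from {w < b - u}, of measure b - u,
     and both lie in B. For u > b the bound by mu B suffices. *)
  move=> u u0; have [ub|bu] := leP u b; last first.
    apply: (@le_trans _ _ (mu B)); last by rewrite muB lee_fin ltW.
    apply: le_measure; rewrite ?inE//; first exact: mlt.
    by move=> x [[]].
  rewrite -(@leeD2rE _ (b - u)%:E)// -EFinD (addrC u) subrK -muB.
  rewrite -(muw (b - u)); [|by rewrite subr_ge0|]; last first.
    apply: (@le_trans _ _ (mu B)).
      by rewrite muB lee_fin lerBlDr lerDl ltW.
    by apply: le_measure; rewrite ?inE.
  rewrite -measureU//; [|exact: mlt|exact: mlt|].
  - apply: le_measure; rewrite ?inE//.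
      by apply: measurableU => //; exact: mlt.
    move=> x [[[]]//|[Dx /= wx]]; apply: contrapT => /(b_le _ Dx).
    by apply/negP; rewrite -ltNge (lt_trans wx)// ltrBlDr ltrDl.
  - apply/seteqP; split => // x [[_ /= bw] [_ /= wx]].
    by move: bw wx; lra.
apply: le_trans (leeD2r _ P_ge); rewrite -EFinD.
have Nfin : (\int[mu]_(x in B `\` A) (w x)%:E)%E \is a fin_num.
  rewrite ge0_fin_numE; last by apply: integral_ge0 => x [/BD/w0].
  apply: le_lt_trans (le_lt_trans N_le (ltry _)); apply: leeDl.
  by rewrite lee_fin divr_ge0// sqr_ge0.
rewrite -(fineK Nfin) in N_le *; move: N_le; set N := fine _.
rewrite -!EFinD !lee_fin => N_le.
(* Here be - al = b - a. If a <= b, the claim amounts to (be - al) (b - (al + be)/2) >= 0, which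
   holds as al <= be <= b. Otherwise be < al and the bounds compare term by term. *)
have [m0|m0] := leP 0 (b - a); nra.
Qed.

(** * Stability on a measure space with a volume coordinate *)

Lemma cauchy_schwarz_support (R : realType) (b : R -> R) (K I : R) : 0 <= K ->
  measurable_fun (`]0, +oo[ : set R) b -> (forall s, 0 <= b s) ->
  (forall s, K <= s -> b s = 0) ->
  (\int[lebesgue_measure]_(s in `]0%R, +oo[) (b s)%:E = I%:E)%E ->
  ((I ^+ 2)%:E <=
   K%:E * \int[lebesgue_measure]_(s in `]0%R, +oo[) (b s ^+ 2)%:E)%E.
Proof.
move=> K0 mb b0 bK bI.
have I0 : 0 <= I by rewrite -lee_fin -bI integral_ge0// => s _; rewrite lee_fin.
move: K0; rewrite le_eqVlt => /predU1P[K0|K0].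
  suff -> : I = 0 by rewrite expr0n mule_ge0 ?lee_fin -?K0// integral_ge0// => s _;
    rewrite lee_fin sqr_ge0.
  apply: EFin_inj; rewrite -bI integral0_eq// => s.
  by rewrite /= in_itv/= andbT => s0; rewrite bK// -K0 ltW.
set J := (\int[lebesgue_measure]_(s in `]0%R, +oo[) (b s ^+ 2)%:E)%E.
have J0 : (0 <= J)%E by apply: integral_ge0 => s _; rewrite lee_fin sqr_ge0.
(* Integrating 2 c b <= b^2 + c^2 over ]0, K[, outside which [b] contributes nothing, gives 2 c I <=
   J + c^2 K, also when J = +oo; c = I / K is the optimal choice. *)
have [c cE] : exists c, c = I / K by exists (I / K).
have c0 : 0 <= c by rewrite cE divr_ge0// ltW.
have mk : measurable_fun (`]0, +oo[ : set R) (\1_(`]0, K[ : set R) : R -> R).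
  exact: measurable_indic.
have key : (((2 * c) * I)%:E <= J + (c ^+ 2 * K)%:E)%E.
  have -> : ((c ^+ 2 * K)%:E =
      \int[lebesgue_measure]_(s in `]0%R, +oo[) (c ^+ 2 * \1_(`]0%R, K[ : set R) s)%:E)%E.
    transitivity ((c ^+ 2)%:E * lebesgue_measure (`]0%R, K[ : set R))%E.
      by rewrite lebesgue_measure_itv/= lte_fin K0 EFinM -EFinB subr0.
    under [RHS]eq_integral do rewrite EFinM.
    rewrite ge0_integralZl_EFin ?sqr_ge0//; last exact/measurable_EFinP.
    rewrite integral_indic//; congr (_ * lebesgue_measure _)%E.
    by apply/esym/setIidl => s /=; rewrite !in_itv/= andbT => /andP[].
  rewrite EFinM -bI -ge0_integralZl_EFin//; last 3 first.
  - by move=> s _; rewrite lee_fin.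
  - exact/measurable_EFinP.
  - by rewrite mulr_ge0.
  rewrite -ge0_integralD//; last 4 first.
  - by move=> s _; rewrite lee_fin sqr_ge0.
  - by apply/measurable_EFinP; exact: measurable_funX.
  - by move=> s _; rewrite lee_fin mulr_ge0 ?sqr_ge0.
  - by apply/measurable_EFinP; exact: measurable_funM.
  apply: ge0_le_integral => //.
  - by move=> s _; rewrite -EFinM lee_fin !mulr_ge0.
  - by apply/measurable_EFinP; exact: measurable_funM.
  - apply/measurable_EFinP/measurable_funD; first exact: measurable_funX.
    exact: measurable_funM.
  move=> s; rewrite /= in_itv/= andbT => s0.
  rewrite -EFinM -EFinD lee_fin indicE; have [sK|Ks] := ltP s K.
    rewrite mem_set/= ?in_itv/= ?s0// mulr1.
    have := sqr_ge0 (b s - c); nra.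
  by rewrite bK// mulr0 addr_ge0 ?sqr_ge0// mulr_ge0// sqr_ge0.
have cK : c * K = I by rewrite cE divfK// gt_eqF.
have [Jfin|] := boolP (J \is a fin_num); last first.
  rewrite ge0_fin_numE// -leNgt leye_eq => /eqP ->.
  by rewrite gt0_muley ?lte_fin// leey.
rewrite -(fineK Jfin) in key *; rewrite -EFinM lee_fin; move: key.
rewrite -EFinD lee_fin -cK; set j := fine J.
have -> : 2 * c * (c * K) = c ^+ 2 * K + c ^+ 2 * K by ring.
rewrite lerD2r => h; have -> : (c * K) ^+ 2 = K * (c ^+ 2 * K) by ring.
by rewrite ler_pM2l.
Qed.

(** Height 0 is dropped: {f > 0} may have infinite measure, and [layer_estimate] asks for level sets
    of finite measure. A single height is negligible, so the integral is unchanged. *)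
Lemma fubini_positive_layers (d : measure_display) (T : measurableType d)
    (R : realType) (mu : {sigma_finite_measure set T -> \bar R}) (D : set T)
    (w g h : T -> R) : measurable D ->
  measurable_fun D w -> (forall x, D x -> 0 <= w x) ->
  measurable_fun D g -> (forall x, D x -> 0 <= g x) ->
  measurable_fun D h ->
  measurable_fun (`]0, +oo[ : set R) (fun s : R =>
    \int[mu]_(x in D `&` [set x | (g x <= s < h x)%R]) (w x)%:E)%E /\
  (\int[lebesgue_measure]_(s in `]0%R, +oo[)
     \int[mu]_(x in D `&` [set x | (g x <= s < h x)%R]) (w x)%:E =
   \int[mu]_(x in D) (w x * Num.max 0 (h x - g x))%:E)%E.
Proof.
move=> mD mw w0 mg g0 mh.
have [m1 e1] := fubini_layers (g := EFin \o g) (h := EFin \o h) mu mD mw w0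
  (proj2 (measurable_EFinP _ _) mg) (proj2 (measurable_EFinP _ _) mh).
have m2 : measurable_fun (`]0, +oo[ : set R) (fun s : R =>
    \int[mu]_(x in D `&` [set x | (g x <= s < h x)%R]) (w x)%:E)%E.
  by apply: measurable_funS m1 => // s /=; rewrite !in_itv/= !andbT => /ltW.
split => //; rewrite integral_itv_obnd_cbnd//.
apply: etrans; first exact: e1.
apply: eq_integral => x /set_mem Dx /=.
by rewrite lebesgue_measure_layer ?EFinM// g0.
Qed.

Lemma measure_positive_layers (d : measure_display) (T : measurableType d)
    (R : realType) (mu : {sigma_finite_measure set T -> \bar R}) (D : set T)
    (g h : T -> R) : measurable D ->
  measurable_fun D g -> (forall x, D x -> 0 <= g x) ->
  measurable_fun D h ->
  measurable_fun (`]0, +oo[ : set R) (fun s : R =>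
    mu (D `&` [set x | g x <= s < h x])) /\
  (\int[lebesgue_measure]_(s in `]0%R, +oo[)
     mu (D `&` [set x | (g x <= s < h x)%R]) =
   \int[mu]_(x in D) (Num.max 0 (h x - g x))%:E)%E.
Proof.
move=> mD mg g0 mh.
have intE s : (\int[mu]_(x in D `&` [set x | (g x <= s < h x)%R]) (1 : R)%:E =
    mu (D `&` [set x | (g x <= s < h x)%R]))%E.
  rewrite -[RHS]mul1e; apply: integral_cst.
  by apply: (measurable_layer (g := EFin \o g) (h := EFin \o h)) => //;
    exact/measurable_EFinP.
have [m1 e1] := fubini_positive_layers (w := cst 1) mu mD (measurable_cst _)
  (fun _ _ => ler01) mg g0 mh.
split; first by apply: eq_measurable_fun m1 => s _; exact: intE.
apply: etrans; last first.
  by apply: etrans e1 _; apply: eq_integral => x _; rewrite mul1r.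
by apply: eq_integral => s _; exact/esym/intE.
Qed.

(** Chebyshev's inequality; it makes [layer_estimate] applicable at every height s > 0. *)
Lemma integrable_level_lty (d : measure_display) (T : measurableType d)
    (R : realType) (mu : {measure set T -> \bar R}) (D : set T) (f : T -> R)
    (s : R) : measurable D -> mu.-integrable D (EFin \o f) -> 0 < s ->
  (mu (D `&` [set x | s%:E < (f x)%:E]) < +oo)%E.
Proof.
move=> mD /integrableP[mf fi] s0.
have := le_lt_trans (le_integral_abse mu mD mf s0) fi.
rewrite -lte_pdivlMl// => h; apply: le_lt_trans.
  2: apply: lt_le_trans; [exact: h|].
  apply: le_measure; rewrite ?inE.
  - exact: emeasurable_fun_o_infty.
  - by apply: emeasurable_fun_c_infty => //; exact: measurableT_comp.
  - move=> x [Dx /=]; rewrite lte_fin lee_fin => sf; split => //=.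
    by rewrite (le_trans (ltW sf))// ler_norm.
exact: leey.
Qed.

(** For w >= 0 the two terms are the integrals of the positive and negative parts, whose difference
    is the integral by definition. The identity thus survives an infinite momentum of f. *)
Lemma integral_weighted_sub (d : measure_display) (T : measurableType d)
    (R : realType) (mu : {measure set T -> \bar R}) (D : set T)
    (w f q : T -> R) : (forall x, D x -> 0 <= w x) ->
  (\int[mu]_(x in D) (w x * (f x - q x))%:E =
   \int[mu]_(x in D) (w x * Num.max 0 (f x - q x))%:E -
   \int[mu]_(x in D) (w x * Num.max 0 (q x - f x))%:E)%E.
Proof.
move=> w0; rewrite integralE; congr (_ - _)%E.
  apply: eq_integral => x /set_mem /w0 wx0.
  by rewrite funeposE/= -EFin_max maxC -{1}[0](mulr0 (w x)) maxr_pMr.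
apply: eq_integral => x /set_mem /w0 wx0.
rewrite funenegE/= -EFin_max maxC -{1}[0](mulr0 (w x)) -mulrN.
by rewrite opprB maxr_pMr.
Qed.

(** Pointwise (f - q)^+ + q = f + (q - f)^+, an identity between nonnegative functions that can be
    integrated against w even if int w f is infinite. The finite integrals of w q and w (q - f)^+
    are then subtracted. *)
Lemma integral_weighted_subE (d : measure_display) (T : measurableType d)
    (R : realType) (mu : {measure set T -> \bar R}) (D : set T)
    (w f q : T -> R) : measurable D ->
  measurable_fun D w -> (forall x, D x -> 0 <= w x) ->
  measurable_fun D f -> (forall x, D x -> 0 <= f x) ->
  measurable_fun D q -> (forall x, D x -> 0 <= q x) ->
  (\int[mu]_(x in D) (w x * q x)%:E < +oo)%E ->
  (\int[mu]_(x in D) (w x * (f x - q x))%:E =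
   \int[mu]_(x in D) (w x * f x)%:E - \int[mu]_(x in D) (w x * q x)%:E)%E /\
  ((\int[mu]_(x in D) (w x * Num.max 0 (q x - f x))%:E)%E \is a fin_num).
Proof.
move=> mD mw w0 mf f0 mq q0 wq.
have mmax (u v : T -> R) : measurable_fun D u -> measurable_fun D v ->
    measurable_fun D (fun x => (w x * Num.max 0 (u x - v x))%:E).
  move=> mu_ mv; apply/measurable_EFinP/measurable_funM => //.
  by apply: measurable_maxr => //; exact: measurable_funB.
have max0 (u v : T -> R) x : D x -> (0 <= (w x * Num.max 0 (u x - v x))%:E)%E.
  by move=> Dx; rewrite lee_fin mulr_ge0 ?w0// le_max lexx.
have mM (u : T -> R) : measurable_fun D u ->
    measurable_fun D (fun x => (w x * u x)%:E).
  by move=> mu_; apply/measurable_EFinP/measurable_funM.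
have wf0 x : D x -> (0 <= (w x * f x)%:E)%E.
  by move=> Dx; rewrite lee_fin mulr_ge0 ?w0 ?f0.
have wq0 x : D x -> (0 <= (w x * q x)%:E)%E.
  by move=> Dx; rewrite lee_fin mulr_ge0 ?w0 ?q0.
have wqfin : (\int[mu]_(x in D) (w x * q x)%:E)%E \is a fin_num.
  by rewrite ge0_fin_numE// integral_ge0.
have negfin : (\int[mu]_(x in D) (w x * Num.max 0 (q x - f x))%:E)%E
    \is a fin_num.
  rewrite ge0_fin_numE; last by apply: integral_ge0 => x; exact: max0.
  apply: le_lt_trans wq; apply: ge0_le_integral => //.
  - by move=> x; exact: max0.
  - exact: mmax.
  - exact: mM.
  - move=> x Dx; rewrite lee_fin ler_wpM2l ?w0// ge_max q0//=.
    by rewrite lerBlDr lerDl f0.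
split=> //; rewrite integral_weighted_sub//.
have e : (\int[mu]_(x in D) (w x * Num.max 0 (f x - q x))%:E +
    \int[mu]_(x in D) (w x * q x)%:E =
    \int[mu]_(x in D) (w x * f x)%:E +
    \int[mu]_(x in D) (w x * Num.max 0 (q x - f x))%:E)%E.
  have mmfq := mmax _ _ mf mq; have mmqf := mmax _ _ mq mf.
  have mwf := mM _ mf; have mwq := mM _ mq.
  rewrite -!ge0_integralD//; try by move=> x; exact: max0.
  apply: eq_integral => x _; rewrite -!EFinD -!mulrDr; congr (_ * _)%:E.
  by rewrite !maxEle; case: ifPn; case: ifPn; lra.
move: e => /(congr1 (fun z => z - \int[mu]_(x in D) (w x * q x)%:E -
  \int[mu]_(x in D) (w x * Num.max 0 (q x - f x))%:E)%E).
rewrite addeK// => ->.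
by rewrite addeAC addeK.
Qed.

(** Pointwise |f - q| + q = f + 2 (q - f)^+, and the integral of f is finite. *)
Lemma integral_norm_sub (d : measure_display) (T : measurableType d)
    (R : realType) (mu : {measure set T -> \bar R}) (D : set T)
    (f q : T -> R) : measurable D ->
  mu.-integrable D (EFin \o f) -> (forall x, D x -> 0 <= f x) ->
  mu.-integrable D (EFin \o q) -> (forall x, D x -> 0 <= q x) ->
  (\int[mu]_(x in D) `|f x - q x|%:E + \int[mu]_(x in D) (q x)%:E -
   \int[mu]_(x in D) (f x)%:E =
   2%:E * \int[mu]_(x in D) (Num.max 0 (q x - f x))%:E)%E /\
  ((\int[mu]_(x in D) (Num.max 0 (q x - f x))%:E)%E \is a fin_num).
Proof.
move=> mD fi f0 qi q0.
have mf : measurable_fun D f by exact/measurable_EFinP/(measurable_int mu fi).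
have mq : measurable_fun D q by exact/measurable_EFinP/(measurable_int mu qi).
have mm : measurable_fun D (fun x => (Num.max 0 (q x - f x))%:E).
  apply/measurable_EFinP/measurable_maxr => //; exact: measurable_funB.
have m0 x : (0 <= (Num.max 0 (q x - f x))%:E)%E.
  by rewrite lee_fin le_max lexx.
have ffin := integrable_fin_num mD fi.
split; last first.
  rewrite ge0_fin_numE; last by apply: integral_ge0.
  have := integrable_lty mD qi; apply: le_lt_trans.
  apply: ge0_le_integral => //; first exact/measurable_EFinP.
  by move=> x Dx; rewrite lee_fin ge_max q0//= lerBlDr lerDl f0.
rewrite -ge0_integralD//; last 2 first.
- by apply/measurable_EFinP/measurableT_comp => //; exact: measurable_funB.
- exact/measurable_EFinP.
rewrite -ge0_integralZl_EFin//.
transitivity (\int[mu]_(x in D) ((f x)%:E + 2%:E * (Num.max 0 (q x - f x))%:E) -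
   \int[mu]_(x in D) (f x)%:E)%E.
  congr (_ - _)%E; apply: eq_integral => x _.
  rewrite -EFinM -!EFinD; congr EFin.
  by rewrite maxEle; case: ifPn => h; case: (ler0P (f x - q x)) => h2; lra.
rewrite ge0_integralD//; last 3 first.
- exact/measurable_EFinP.
- by move=> x _; rewrite mule_ge0.
- exact: measurable_funeM.
by rewrite addeAC subee// add0e.
Qed.

(** [K] stands for an essential bound of q and [bs] for any majorant of (mu_q - mu_f)^+. Leaving
    [bs] free separates this estimate from rearrangements, which enter only when [bs] is chosen. *)
Theorem volume_coordinate_stability (d : measure_display)
    (T : measurableType d) (R : realType)
    (mu : {sigma_finite_measure set T -> \bar R}) (D : set T)
    (w f q : T -> R) (K : R) (bs : R -> \bar R) :
  measurable D -> volume_coordinate mu D w ->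
  mu.-integrable D (EFin \o f) -> (forall x, D x -> 0 <= f x) ->
  mu.-integrable D (EFin \o q) -> (forall x, D x -> 0 <= q x) ->
  (forall x y, D x -> D y -> w x <= w y -> q y <= q x) ->
  0 <= K -> {ae mu, forall x, D x -> q x <= K} ->
  (\int[mu]_(x in D) (w x * q x)%:E < +oo)%E ->
  measurable_fun (`]0, +oo[ : set R) bs -> (forall s, 0 <= bs s)%E ->
  (forall s : R, 0 < s -> (mu (D `&` [set x | (s%:E < (q x)%:E)%E]) <=
     mu (D `&` [set x | (s%:E < (f x)%:E)%E]) + bs s)%E) ->
  ((\int[mu]_(x in D) `|f x - q x|%:E + \int[mu]_(x in D) (q x)%:E -
    \int[mu]_(x in D) (f x)%:E) ^+ 2 <=
   (4 * K)%:E * (\int[mu]_(x in D) (w x * (f x - q x))%:E +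
     2%:E * \int[lebesgue_measure]_(s in `]0%R, +oo[)
       (mu (D `&` [set x | (s%:E < (q x)%:E)%E]) * bs s)))%E.
Proof.
move=> mD vw fi f0 qi q0 qw K0 qK wq mbs bs0 hbs.
have [mw w0 _ _] := vw.
have mf : measurable_fun D f by exact/measurable_EFinP/(measurable_int mu fi).
have mq : measurable_fun D q by exact/measurable_EFinP/(measurable_int mu qi).
have [-> Ifin] := integral_norm_sub mD fi f0 qi q0.
have [_ Nfin] := integral_weighted_subE (mu := mu) mD mw w0 mf f0 mq q0 wq.
rewrite integral_weighted_sub//.
have [mP PE] := fubini_positive_layers mu mD mw w0 mq q0 mf.
have [mN NE] := fubini_positive_layers mu mD mw w0 mf f0 mq.
have [mb bE] := measure_positive_layers mu mD mf f0 mq.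
have [mqs _] := measure_positive_layers mu mD (measurable_cst (0 : R))
  (fun _ _ => lexx 0) mq.
have qsE (s : R) : 0 < s -> mu (D `&` [set x | (s%:E < (q x)%:E)%E]) =
    mu (D `&` [set x | (cst 0 x <= s < q x)]).
  move=> s0; congr (mu _); apply/seteqP; split => x [Dx] /=; rewrite lte_fin.
    by move=> ->; rewrite ltW.
  by move=> /andP[].
have {}mqs : measurable_fun (`]0, +oo[ : set R)
    (fun s : R => mu (D `&` [set x | (s%:E < (q x)%:E)%E])).
  apply: eq_measurable_fun mqs => s; rewrite inE/= in_itv/= andbT => s0.
  by rewrite -qsE.
have mlev (u : T -> R) s : measurable_fun D u ->
    measurable (D `&` [set x | (s%:E < (u x)%:E)%E]).
  by move=> /measurable_EFinP mu_; exact: emeasurable_fun_o_infty.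
have layerE (u v : T -> R) s :
    (D `&` [set x | (s%:E < (v x)%:E)%E]) `\` (D `&` [set x | (s%:E < (u x)%:E)%E])
    = D `&` [set x | u x <= s < v x].
  apply/seteqP; split => x /=; rewrite !lte_fin.
    move=> [[Dx ->] h]; split => //; rewrite andbT leNgt; apply/negP => su.
    exact: h.
  by move=> [Dx /andP[us ->]]; split => // -[_]; rewrite ltNge us.
set I := (\int[mu]_(x in D) (Num.max 0 (q x - f x))%:E)%E in Ifin bE *.
pose b s := fine (mu (D `&` [set x | f x <= s < q x])).
have bfin s : 0 < s -> (b s)%:E = mu (D `&` [set x | f x <= s < q x]).
  move=> s0; rewrite fineK// ge0_fin_numE//.
  apply: le_lt_trans (integrable_level_lty mD qi s0).
  rewrite -layerE; apply: le_measure; rewrite ?inE//.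
  - by apply: measurableD; exact: mlev.
  - exact: mlev.
have mb' : measurable_fun (`]0, +oo[ : set R) b.
  apply/measurable_EFinP; apply: eq_measurable_fun mb => s.
  by rewrite inE/= in_itv/= andbT => s0; rewrite -bfin.
have bI : (\int[lebesgue_measure]_(s in `]0%R, +oo[) (b s)%:E = (fine I)%:E)%E.
  rewrite fineK// -bE; apply: eq_integral => s.
  by rewrite inE/= in_itv/= andbT => s0; rewrite -bfin.
(* For s >= K the set {f <= s < q} lies in the null set where the bound q <= K fails. *)
have bK s : K <= s -> b s = 0.
  move=> Ks; rewrite /b (_ : mu _ = 0%E)//.
  have [N [mN_ N0 qN]] := qK.
  apply: (subset_measure0 _ mN_ _ N0).
    rewrite -layerE; apply: measurableD; exact: mlev.
  move=> x [Dx /= /andP[_ sq]]; apply: qN => /(_ Dx) qxK.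
  by move: sq; rewrite ltNge (le_trans qxK Ks).
have b0 s : 0 <= b s by exact/fine_ge0/measure_ge0.
have CS := cauchy_schwarz_support K0 mb' b0 bK bI.
have pointwise s : 0 < s ->
    ((b s ^+ 2)%:E +
       \int[mu]_(x in D `&` [set x | (f x <= s < q x)%R]) (w x)%:E <=
     \int[mu]_(x in D `&` [set x | (q x <= s < f x)%R]) (w x)%:E +
     2%:E * (mu (D `&` [set x | (s%:E < (q x)%:E)%E]) * bs s))%E.
  move=> s0.
  have ql := integrable_level_lty mD qi s0.
  have fl := integrable_level_lty mD fi s0.
  have Bdown x y : D x -> D y -> w x <= w y ->
      (D `&` [set x | (s%:E < (q x)%:E)%E]) y ->
      (D `&` [set x | (s%:E < (q x)%:E)%E]) x.
    move=> Dx Dy wxy [_ /=]; rewrite lte_fin => sq; split => //=.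
    by rewrite lte_fin (lt_le_trans sq)// qw.
  have := layer_estimate mD (mlev _ s mf) (mlev _ s mq) (@subIsetl _ _ _)
    (@subIsetl _ _ _) vw Bdown fl ql.
  rewrite !layerE => h; apply: le_trans h _; rewrite leeD2l//.
  have qfin : mu (D `&` [set x | (s%:E < (q x)%:E)%E]) \is a fin_num.
    by rewrite ge0_fin_numE.
  have ffin : mu (D `&` [set x | (s%:E < (f x)%:E)%E]) \is a fin_num.
    by rewrite ge0_fin_numE.
  rewrite -mulrA EFinM lee_pmul2l// EFinM fineK// lee_pmul//.
    by rewrite lee_fin le_max lexx.
  rewrite EFin_max ge_max bs0/= EFinB !fineK// leeBlDl//; exact: hbs.
set M := (\int[lebesgue_measure]_(s in _) (_ * _))%E.
have M0 : (0 <= M)%E by apply: integral_ge0 => s _; rewrite mule_ge0.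
have int_ge0 (E : set T) : E `<=` D -> (0 <= \int[mu]_(x in E) (w x)%:E)%E.
  by move=> ED; apply: integral_ge0 => x /ED/w0.
(* This is [pointwise] integrated over s > 0. The term in (q - f)^+ stays on the left until the end,
   where it is subtracted because it is finite ([Nfin]). *)
have main : (\int[lebesgue_measure]_(s in `]0%R, +oo[) (b s ^+ 2)%:E +
    \int[mu]_(x in D) (w x * Num.max 0 (q x - f x))%:E <=
    \int[mu]_(x in D) (w x * Num.max 0 (f x - q x))%:E + 2%:E * M)%E.
  have mM : measurable_fun (`]0, +oo[ : set R) (fun s : R =>
      mu (D `&` [set x | (s%:E < (q x)%:E)%E]) * bs s)%E.
    exact: emeasurable_funM.
  rewrite -PE -NE /M -ge0_integralZl//; last first.
    by move=> s _; rewrite mule_ge0.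
  have mb2 : measurable_fun (`]0, +oo[ : set R) (fun s => (b s ^+ 2)%:E).
    by apply/measurable_EFinP; exact: measurable_funX.
  rewrite -!ge0_integralD//; last 5 first.
  - by move=> s _; apply: int_ge0 => x [].
  - by move=> s _; rewrite !mule_ge0.
  - exact: measurable_funeM.
  - by move=> s _; rewrite lee_fin sqr_ge0.
  - by move=> s _; apply: int_ge0 => x [].
  apply: ge0_le_integral => //.
  - by move=> s _; rewrite adde_ge0// ?lee_fin ?sqr_ge0//; apply: int_ge0 => x [].
  - exact: emeasurable_funD.
  - by apply: emeasurable_funD => //; exact: measurable_funeM.
  - by move=> s; rewrite /= in_itv/= andbT; exact: pointwise.
rewrite -(fineK Ifin) -EFinM -EFin_expe exprMn.
set P := (\int[mu]_(x in D) (w x * Num.max 0 (f x - q x))%:E)%E in main *.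
set N := (\int[mu]_(x in D) (w x * Num.max 0 (q x - f x))%:E)%E in main Nfin *.
(* The 4 is the square of the factor 2 in [integral_norm_sub]; K comes from Cauchy-Schwarz. *)
have -> : (2 : R) ^+ 2 = 4 by rewrite -natrX.
rewrite !EFinM -muleA lee_pmul2l//.
apply: le_trans CS _; apply: lee_wpmul2l => //.
by rewrite addeAC leeBrDr.
Qed.

(** * Discs and rectangles *)

(** The plane carries the product sigma-algebra, so an open set is written as a countable union of
    rational boxes; [F] returns the empty set for a box not contained in U. This serves the
    measurability of [Supp]. *)
Lemma open_measurable2 (R : realType) (U : set (R * R)) :
  open U -> measurable U.
Proof.
move=> oU.
pose F (c1 r1 c2 r2 : rat) : set (R * R) :=
  let P := ball (ratr c1 : R) (ratr r1) `*` ball (ratr c2 : R) (ratr r2) in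
  if `[< P `<=` U >] then P else set0.
rewrite (_ : U = \bigcup_c1 \bigcup_r1 \bigcup_c2 \bigcup_r2 F c1 r1 c2 r2).
  do 4 (apply: bigcupT_measurable_rat => ?); rewrite /F; case: ifPn => // _.
  by apply: measurableX; exact: measurable_ball.
apply/seteqP; split => [[x y] Uxy|z [c1 _ [r1 _ [c2 _ [r2 _]]]]]; last first.
  by rewrite /F; case: ifPn => // /asboolP; exact.
have [e /= e0 eU] : exists2 e : R, 0 < e & ball (x, y) e `<=` U.
  by have /nbhs_ballP[e /= e0 eU] := open_nbhs_nbhs (conj oU Uxy); exists e.
have xe : x \in (ball x e : set R) by rewrite inE; exact: ballxx.
have ye : y \in (ball y e : set R) by rewrite inE; exact: ballxx.
have [c1 [r1 /= [/set_mem xB1 B1]]] := open_subball_rat (ball_open x e) xe.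
have [c2 [r2 /= [/set_mem yB2 B2]]] := open_subball_rat (ball_open y e) ye.
exists c1 => //; exists r1 => //; exists c2 => //; exists r2 => //.
rewrite /F asboolT//= => -[u v] [/= u1 v2]; apply: eU.
by split; [exact: B1|exact: B2].
Qed.

Lemma closed_measurable2 (R : realType) (C : set (R * R)) :
  closed C -> measurable C.
Proof.
by move=> /closed_openC/open_measurable2/measurableC; rewrite setCK.
Qed.

Lemma enorm_ge0 (R : realType) (x : R * R) : 0 <= enorm x.
Proof. exact: sqrtr_ge0. Qed.

Lemma enorm_sqr (R : realType) (x : R * R) :
  enorm x ^+ 2 = x.1 ^+ 2 + x.2 ^+ 2.
Proof. by rewrite sqr_sqrtr// addr_ge0// sqr_ge0. Qed.

Lemma measurable_enorm (R : realType) : measurable_fun [set: R * R] (@enorm R).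
Proof.
apply: measurableT_comp.
  by apply: continuous_measurable_fun; exact: sqrt_continuous.
by apply: measurable_funD; apply: measurable_funX;
  [exact: measurable_fst|exact: measurable_snd].
Qed.

Lemma measurable_disc (R : realType) (rad : \bar R) : measurable (disc rad).
Proof.
rewrite /disc -[X in measurable X]setTI.
apply: emeasurable_fun_infty_o => //.
by apply/measurable_EFinP; exact: measurable_enorm.
Qed.

(** [Num.sqrt] vanishes on negative numbers, so the formula also gives the empty section when |x| >=
    r. *)
Lemma xsection_disc (R : realType) (r x : R) : 0 <= r ->
  xsection (disc r%:E) x =
  `]- Num.sqrt (r ^+ 2 - x ^+ 2), Num.sqrt (r ^+ 2 - x ^+ 2)[%classic.
Proof.
move=> r0; have key (y : R) : (enorm (x, y) < r) = (x ^+ 2 + y ^+ 2 < r ^+ 2).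
  by rewrite -(enorm_sqr (x, y)) ltr_pXn2r// nnegrE// enorm_ge0.
apply/seteqP; split => y.
  move=> /xsectionP; rewrite /disc/= lte_fin key in_itv/= -ltr_norml => h.
  by rewrite -(sqrtr_sqr y) ltr_sqrt; move: (sqr_ge0 y); lra.
rewrite /= in_itv/= -ltr_norml => h; apply/xsectionP.
rewrite /disc/= lte_fin key.
have p : 0 < r ^+ 2 - x ^+ 2 by rewrite -sqrtr_gt0; exact: le_lt_trans h.
by move: h; rewrite -(sqrtr_sqr y) ltr_sqrt//; lra.
Qed.

(** The substitution x = r sin t on [-pi/2, pi/2] leads to the integral of r^2 cos^2 t, with
    antiderivative [H]. *)
Lemma half_disc_integral (R : realType) (r : R) : 0 < r ->
  (\int[lebesgue_measure]_(x in `[(- r)%R, r]) (Num.sqrt (r ^+ 2 - x ^+ 2))%:E =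
   (pi / 2 * r ^+ 2)%:E)%E.
Proof.
move=> r0.
have pi0 := pi_gt0 R.
pose F (t : R) := r * sin t.
have dF (t : R) : is_derive t 1 F (r * cos t).
  rewrite /F; apply: is_derive_eq.
  by rewrite /GRing.scale/= ?mulr1.
have F'E : F^`()%classic = fun t => r * cos t.
  by apply/funext => t; rewrite derive1E derive_val.
have cF : continuous F.
  by move=> t; apply: differentiable_continuous; apply/derivable1_diffP; exact: ex_derive.
have cF' : continuous (fun t : R => r * cos t).
  by move=> t; apply: cvgM; [exact: cvg_cst|exact: continuous_cos].
have FN : F (- (pi / 2)) = - r by rewrite /F sinN sin_pihalf mulrN mulr1.
have FP : F (pi / 2) = r by rewrite /F sin_pihalf mulr1.
rewrite (_ : `[(- r), r]%classic = `[F (- (pi / 2)), F (pi / 2)]%classic);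
  last by rewrite FN FP.
rewrite integration_by_substitution_increasing.
- transitivity (\int[lebesgue_measure]_(t in `[(- (pi / 2))%R, (pi / 2)%R])
      (r ^+ 2 * cos t ^+ 2)%:E)%E.
    rewrite F'E; apply: eq_integral => t; rewrite inE/= in_itv/= => tpi; congr EFin.
    rewrite /F fctE /= exprMn -{1}(mulr1 (r ^+ 2)) -mulrBr -cos2sin2.
    rewrite sqrtrM ?sqr_ge0// !sqrtr_sqr (ger0_norm (ltW r0)).
    by rewrite (ger0_norm (cos_ge0_pihalf tpi)); ring.
  pose H (t : R) := r ^+ 2 / 2 * (t + sin t * cos t).
  have dH (t : R) : is_derive t 1 H (r ^+ 2 * cos t ^+ 2).
    rewrite /H; apply: is_derive_eq.
    rewrite /GRing.scale/= ?mulr1.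
    have := cos2Dsin2 t; nra.
  have cH t : {for t, continuous H}.
    by apply: differentiable_continuous; apply/derivable1_diffP; exact: ex_derive.
  rewrite (@continuous_FTC2 _ _ H)//.
  + rewrite -EFinB; congr EFin; rewrite /H sinN cosN cos_pihalf !mulr0 !addr0.
    by field.
  + by lra.
  + apply: continuous_subspaceT => t; apply: cvgM; first exact: cvg_cst.
    by apply: cvgM; exact: continuous_cos.
  + split => //.
    * by apply: cvg_at_right_filter; exact: cH.
    * by apply: cvg_at_left_filter; exact: cH.
  + by move=> s _; rewrite derive1E derive_val.
- lra.
- move=> x y xI yI xy; rewrite /F ltr_pM2l// ltr_sin//; exact/mem_set.
- by rewrite F'E => t _; exact: cF'.
- by rewrite F'E; apply/cvg_ex; eexists; apply: cvg_at_right_filter; exact: cF'.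
- by rewrite F'E; apply/cvg_ex; eexists; apply: cvg_at_left_filter; exact: cF'.
- split => //.
  + by apply: cvg_at_right_filter; exact: cF.
  + by apply: cvg_at_left_filter; exact: cF.
- apply: continuous_subspaceT => x; apply: continuous_comp; last first.
    exact: sqrt_continuous.
  by apply: cvgB; [exact: cvg_cst|exact: exprn_continuous].
Qed.

Lemma disc_area (R : realType) (r : R) : 0 <= r ->
  leb2 (disc r%:E) = (pi * r ^+ 2)%:E.
Proof.
rewrite le_eqVlt => /predU1P[<-|r0].
  rewrite (_ : disc _ = set0) ?measure0 ?expr0n ?mulr0//.
  apply/seteqP; split => // x; rewrite /disc/= lte_fin => /(le_lt_trans (enorm_ge0 x)).
  by rewrite ltxx.
have -> : (pi * r ^+ 2)%:E = (2%:E * (pi / 2 * r ^+ 2)%:E)%E :> \bar R.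
  by rewrite -EFinM; congr EFin; field.
have ms : measurable_fun [set: R] (fun x : R => Num.sqrt (r ^+ 2 - x ^+ 2)).
  apply: continuous_measurable_fun => x; apply: continuous_comp; last first.
    exact: sqrt_continuous.
  by apply: cvgB; [exact: cvg_cst|exact: exprn_continuous].
rewrite -half_disc_integral// -ge0_integralZl_EFin//; last first.
  by apply/measurable_EFinP; exact: measurable_funS ms.
rewrite [RHS]integral_mkcond; apply: eq_integral => x _ /=.
rewrite xsection_disc ?ltW// patchE.
have h (s : R) : 0 <= s ->
    lebesgue_measure (`](- s), s[ : set R) = (2%:E * s%:E)%E.
  move=> s0; rewrite lebesgue_measure_itv/= lte_fin -EFinM; case: ifPn => [_|].
    by rewrite -EFinB opprK mulr_natl mulr2n.
  by rewrite -leNgt => h1; congr EFin; lra.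
rewrite [LHS]h ?sqrtr_ge0//; case: ifPn => // xN.
rewrite ler0_sqrtr ?mule0// subr_le0 -[x ^+ 2]real_normK ?num_real//.
rewrite ler_pXn2r ?nnegrE ?(ltW r0)// leNgt; apply/negP => xr.
move/negP: xN; apply; rewrite inE/= in_itv/= -ler_norml; exact: ltW.
Qed.

Lemma setT_area (R : realType) : leb2 [set: R * R] = +oo%E.
Proof.
apply/eqP; rewrite -leye_eq; apply: (@le_trans _ _ (+oo * +oo)%E).
  by rewrite mulyy.
rewrite -setXTT product_measure1E//.
have h : (+oo <= lebesgue_measure [set: R])%E.
  by rewrite -set_itvNyy lebesgue_measure_itv/=.
by apply: lee_pmul => //; exact: h.
Qed.

(** The set {pi |x|^2 < r} is the disc of radius sqrt (r / pi), of area r; the restriction r <= leb2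
    (disc rad) keeps it inside the domain. *)
Lemma disc_volume_coordinate (R : realType) (rad : \bar R) : (0 < rad)%E ->
  volume_coordinate leb2 (disc rad) (fun x => pi * enorm x ^+ 2).
Proof.
move=> rad0; have pi0 := pi_gt0 R.
have mw : measurable_fun [set: R * R] (fun x : R * R => pi * enorm x ^+ 2).
  apply: measurable_funM => //; apply: measurable_funX.
  exact: measurable_enorm.
have lev r : 0 <= r -> [set x : R * R | pi * enorm x ^+ 2 < r] =
    disc (Num.sqrt (r / pi))%:E.
  move=> r0; apply/seteqP; split => x; rewrite /disc/= lte_fin -ltr_pdivlMl// mulrC.
    move=> h; rewrite -(ger0_norm (enorm_ge0 x)) -sqrtr_sqr ltr_sqrt//.
    exact: le_lt_trans (sqr_ge0 _) h.
  rewrite -{1}(ger0_norm (enorm_ge0 x)) -sqrtr_sqr => h.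
  by rewrite -ltr_sqrt// -sqrtr_gt0; apply: le_lt_trans h; exact: sqrtr_ge0.
have levE r : 0 <= r -> leb2 [set x : R * R | pi * enorm x ^+ 2 < r] = r%:E.
  move=> r0; rewrite lev// disc_area ?sqrtr_ge0// sqr_sqrtr ?divr_ge0 ?(ltW pi0)//.
  by rewrite mulrC divfK ?gt_eqF.
case: rad rad0 => [a| |//]; rewrite ?lte_fin => a0; last first.
  have -> : disc (+oo : \bar R)%E = setT.
    by apply/seteqP; split => // x _; rewrite /disc/= ltry.
  split => //.
  - by move=> x _; rewrite mulr_ge0 ?sqr_ge0// ltW.
  - by move=> x _; rewrite setT_area leey.
  - by move=> s s0 _; rewrite setTI levE.
split => //.
- exact: measurable_funTS.
- by move=> x _; rewrite mulr_ge0 ?sqr_ge0// ltW.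
- move=> x; rewrite /disc/= lte_fin => xr.
  rewrite disc_area ?(ltW a0)// lee_fin ler_pM2l//.
  by rewrite ler_pXn2r ?nnegrE ?enorm_ge0 ?(ltW a0) ?(ltW xr).
- move=> s s0; rewrite disc_area ?(ltW a0)// lee_fin => sr.
  rewrite setIidr ?levE// => x /=; rewrite /disc/= lte_fin => xs.
  have : pi * enorm x ^+ 2 < pi * a ^+ 2 by exact: lt_le_trans sr.
  by rewrite ltr_pM2l// ltr_pXn2r// nnegrE ?enorm_ge0// (ltW a0).
Qed.

Lemma rect_setX (R : realType) (L1 : R) (L2 : \bar R) :
  rect L1 L2 = `]0, L1[%classic `*` [set y : R | 0 < y /\ (y%:E < L2)%E].
Proof.
apply/seteqP; split => x; rewrite /rect/= in_itv/=.
  by move=> [-> -> -> ->].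
by move=> [/andP[-> ->] [-> ->]].
Qed.

Lemma lebesgue_measure_itv0 (R : realType) (L : \bar R) : (0 < L)%E ->
  measurable [set y : R | 0 < y /\ (y%:E < L)%E] /\
  lebesgue_measure [set y : R | 0 < y /\ (y%:E < L)%E] = L.
Proof.
case: L => [l| |//]; rewrite ?lte_fin => l0.
  rewrite (_ : mkset _ = `]0, l[%classic); last first.
    by apply/seteqP; split => y/=; rewrite in_itv/= lte_fin => /andP.
  by split=> //; rewrite lebesgue_measure_itv/= lte_fin l0 -EFinB subr0.
rewrite (_ : mkset _ = `]0, +oo[%classic); last first.
  by apply/seteqP; split => y/=; rewrite in_itv/= andbT ltry // => -[].
by split=> //; rewrite lebesgue_measure_itv/= ltry.
Qed.

Lemma measurable_rect (R : realType) (L1 : R) (L2 : \bar R) : (0 < L2)%E ->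
  measurable (rect L1 L2).
Proof.
move=> L20; rewrite rect_setX; apply: measurableX => //.
by have [] := lebesgue_measure_itv0 L20.
Qed.

Lemma rect_area (R : realType) (L1 : R) (L2 : \bar R) : 0 < L1 -> (0 < L2)%E ->
  leb2 (rect L1 L2) = (L1%:E * L2)%E.
Proof.
move=> L10 L20; have [mL mE] := lebesgue_measure_itv0 L20.
rewrite rect_setX product_measure1E// [X in (_ * X)%E]mE.
congr (_ * _)%E; transitivity (lebesgue_measure (`]0, L1[ : set R)) => //.
by rewrite lebesgue_measure_itv/= lte_fin L10 -EFinB subr0.
Qed.

Lemma rect_volume_coordinate (R : realType) (L1 : R) (L2 : \bar R) :
  0 < L1 -> (0 < L2)%E ->
  volume_coordinate leb2 (rect L1 L2) (fun x => L1 * x.2).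
Proof.
move=> L10 L20; split.
- by apply: measurable_funTS; apply: measurable_funM => //; exact: measurable_snd.
- by move=> x [_ _ x0 _]; rewrite mulr_ge0// ltW.
- move=> x [_ _ x0 xL]; rewrite rect_area// EFinM lee_pmul ?lee_fin// ltW//.
- move=> r r0; rewrite rect_area// => rL.
  have [->|rn0] := eqVneq r 0.
    rewrite (_ : _ `&` _ = set0) ?measure0//.
    apply/seteqP; split => // x [[_ _ x0 _]] /=.
    by rewrite ltNge mulr_ge0// ltW.
  have rp : 0 < r by rewrite lt_neqAle eq_sym rn0.
  have rLp : (0 < (r / L1)%:E)%E by rewrite lte_fin divr_gt0.
  rewrite (_ : _ `&` _ = rect L1 (r / L1)%:E).
    by rewrite rect_area// -EFinM mulrC divfK// gt_eqF.
  apply/seteqP; split => [x [[x0 xL x20 _]] /= h|x [x0 xL x20]].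
    by split => //; rewrite lte_fin ltr_pdivlMr// mulrC.
  rewrite lte_fin ltr_pdivlMr// mulrC => h; split => //; split => //.
  have : ((L1 * x.2)%:E < L1%:E * L2)%E by exact: lt_le_trans rL.
  by rewrite EFinM lte_pmul2l.
Qed.

(** * Rearrangements *)

(** The function U t = mu (D & {w < t}) starts at 0, is nondecreasing, and is 1-Lipschitz because {a
    <= w < b} has measure b - a. By an intermediate value argument it reaches r at c = sup {t | U t
    < r}; if U stays below r, then r = mu D and c = +oo. For w = pi |x|^2 this finds the disc that
    cuts area r out of D. *)
Lemma volume_level (d : measure_display) (T : measurableType d) (R : realType)
    (mu : {measure set T -> \bar R}) (D : set T) (w : T -> R) (r : \bar R) :
  measurable D -> measurable_fun [set: T] w -> (forall x, 0 <= w x) ->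
  (forall t : R, 0 <= t -> mu [set x | w x < t] = t%:E) ->
  (0 <= r <= mu D)%E ->
  exists2 c : \bar R,
    D `&` [set x | (mu (D `&` [set y | (w y < w x)%R]) < r)%E] =
    D `&` [set x | ((w x)%:E < c)%E]
    & mu (D `&` [set x | ((w x)%:E < c)%E]) = r.
Proof.
move=> mD mw w0 muw /andP[r0 rD].
pose U (t : R) := mu (D `&` [set y | w y < t]).
have mlt (t : R) : measurable [set x | w x < t].
  rewrite -[X in measurable X]setTI.
  have /measurable_EFinP mew := mw.
  by have := emeasurable_fun_infty_o measurableT mew t%:E;
    under eq_set do rewrite lte_fin.
have mDlt t : measurable (D `&` [set x | w x < t]) by exact: measurableI.
have Umono (a b : R) : a <= b -> (U a <= U b)%E.
  move=> ab; apply: le_measure; rewrite ?inE// => x [Dx /= wx]; split => //=.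
  exact: lt_le_trans ab.
have Ule (t : R) : 0 <= t -> (U t <= t%:E)%E.
  by move=> t0; rewrite -muw//; apply: le_measure; rewrite ?inE// => x [].
have U0 : U 0 = 0%E by apply/eqP; rewrite eq_le Ule//= measure_ge0.
have Ulip (a b : R) : 0 <= a -> a <= b -> (U b <= U a + (b - a)%:E)%E.
  move=> a0 ab; have b0 := le_trans a0 ab.
  have mba : measurable ([set x | w x < b] `\` [set x | w x < a]).
    exact: measurableD.
  have -> : (b - a)%:E = mu ([set x | w x < b] `\` [set x | w x < a]).
    have mub : (mu [set x | (w x < b)%R] < +oo)%E by rewrite muw// ltry.
    have -> : mu ([set x | w x < b] `\` [set x | w x < a]) =
        (mu [set x | (w x < b)%R] -
         mu ([set x | (w x < b)%R] `&` [set x | (w x < a)%R]))%E.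
      exact: measureD.
    rewrite setIidr; first by rewrite !muw.
    by move=> x /= wx; exact: lt_le_trans ab.
  apply: le_trans (measureU2 _ _ _) => //.
  apply: le_measure; rewrite ?inE//; first exact: measurableU.
  move=> x [Dx /= wb]; have [wa|aw] := ltP (w x) a; first by left.
  by right; split => //=; apply/negP; rewrite -leNgt.
have ally : D `&` [set x | ((w x)%:E < +oo)%E] = D.
  by apply: setIidl => x _; rewrite /= ltry.
case: r r0 rD => [r| |//] r0 rD; last first.
  exists +oo%E.
    rewrite ally; apply: setIidl => x _ /=.
    by apply: le_lt_trans (ltry (w x)); exact: Ule.
  by rewrite ally; apply/eqP; rewrite eq_le rD leey.
rewrite lee_fin in r0.
have [Uall|/existsNP[t1 /not_implyP[t10 /negP]]] :=
  pselect (forall t, 0 <= t -> (U t < r%:E)%E).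
  exists +oo%E.
    by rewrite ally; apply: setIidl => x _ /=; exact: Uall.
  rewrite ally; apply/eqP; rewrite eq_le rD andbT.
  have DE : D = \bigcup_n (D `&` [set x | w x < n%:R]).
    apply/seteqP; split => [x Dx|x [n _ []]//].
    by exists (Num.bound (w x)) => //; split => //=; exact: archi_boundP.
  have cvgD : mu (D `&` [set x | w x < n%:R]) @[n --> \oo] --> mu D.
    rewrite [X in _ --> mu X]DE.
    apply: nondecreasing_cvg_mu => //.
      by rewrite -DE.
    move=> m n mn; apply/subsetPset => x [Dx /= wx]; split => //=.
    by rewrite (lt_le_trans wx)// ler_nat.
  rewrite -(cvg_lim _ cvgD)//; apply: lime_le.
    by apply/cvg_ex; exists (mu D).
  by apply: nearW => n; apply/ltW/Uall.
rewrite -leNgt => rU1.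
(* 0 is added so that [S] is nonempty when r = 0. *)
pose S := [set t : R | t = 0 \/ 0 <= t /\ (U t < r%:E)%E].
have S_le t : S t -> (U t <= r%:E)%E.
  by move=> [->|[_ /ltW//]]; rewrite U0 lee_fin.
have S_ge0 t : S t -> 0 <= t by move=> [->|[]].
have S_ub : ubound S t1.
  move=> t [->//|[_ Ut]]; rewrite leNgt; apply/negP => /ltW /Umono.
  by apply/negP; rewrite -ltNge (lt_le_trans Ut).
have S0 : S 0 by left.
have S_sup : has_sup S by split; [exists 0|exists t1].
pose sg := sup S.
have sg_ub t : S t -> t <= sg by move=> St; apply: sup_ubound => //; exists t1.
have sg0 : 0 <= sg by exact: sg_ub.
have Usg : U sg = r%:E.
  apply/eqP; rewrite eq_le; apply/andP; split; apply/lee_addgt0Pr => e e0.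
    have [s Ss ss] := sup_adherent e0 S_sup.
    apply: le_trans (Ulip s sg (S_ge0 _ Ss) (sg_ub _ Ss)) _.
    by apply: leeD; [exact: S_le|rewrite lee_fin; move: ss; rewrite -/sg; lra].
  have NS : ~ S (sg + e) by move=> /sg_ub; lra.
  have rUe : (r%:E <= U (sg + e)%R)%E.
    rewrite leNgt; apply/negP => Ue; apply: NS; right; split => //.
    by rewrite addr_ge0// ltW.
  apply: (le_trans rUe); have := Ulip sg (sg + e) sg0.
  by rewrite lerDl (ltW e0) (addrC sg) addrK; exact.
exists sg%:E; last by rewrite -[RHS]Usg; congr (mu (D `&` _));
  apply/seteqP; split => x /=; rewrite lte_fin.
apply/seteqP; split => x [Dx /= h]; split => //=; rewrite ?lte_fin.
  rewrite lt_neqAle; apply/andP; split.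
    by apply/eqP => e; move: h; rewrite e -/(U _) Usg ltxx.
  by apply: sg_ub; right.
rewrite lte_fin in h.
(* Some s in [S] exceeds w x; it is not the added 0, as w >= 0, so U (w x) <= U s < r. *)
have e0 : 0 < sg - w x by rewrite subr_gt0.
have [s Ss] := sup_adherent e0 S_sup.
rewrite -/sg opprB addrC subrK => ws; case: Ss => [s0|[_ Us]].
  by move: ws; rewrite s0 ltNge w0.
by apply: le_lt_trans Us; apply: Umono; exact: ltW.
Qed.

Lemma distr_funS (R : realType) (Omega : set (R * R)) (g : R * R -> \bar R)
    (s t : R) : measurable Omega -> measurable_fun Omega g -> s <= t ->
  (distr_fun Omega g t <= distr_fun Omega g s)%E.
Proof.
move=> mO mg st; apply: le_measure; rewrite ?inE.
- exact: emeasurable_fun_o_infty.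
- exact: emeasurable_fun_o_infty.
- by move=> x [Ox /= tg]; split => //=; apply: le_lt_trans tg; rewrite lee_fin.
Qed.

(** Since {g > s} is the increasing union of the sets {g > s + 1/(n + 1)}, mu_g is
    right-continuous. *)
Lemma distr_fun_right (R : realType) (Omega : set (R * R))
    (g : R * R -> \bar R) (s : R) (m : \bar R) :
  measurable Omega -> measurable_fun Omega g ->
  (m < distr_fun Omega g s)%E ->
  exists2 t : R, s < t & (m < distr_fun Omega g t)%E.
Proof.
move=> mO mg ms; apply: contrapT => /forall2NP h.
have le_m t : s < t -> (distr_fun Omega g t <= m)%E.
  by move=> st; have [//|/negP] := h t; rewrite -leNgt.
pose F n := Omega `&` [set x | ((s + n.+1%:R^-1)%:E < g x)%E].
have mF n : measurable (F n) by exact: emeasurable_fun_o_infty.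
have FE : Omega `&` [set x | (s%:E < g x)%E] = \bigcup_n F n.
  apply/seteqP; split => [x [Ox /= sg]|x [n _ [Ox /= ng]]].
    suff [n ng] : exists n : nat, ((s + n.+1%:R^-1)%:E < g x)%E by exists n.
    move: sg; case: (g x) => [y| |//]; last by exists 0%N; rewrite ltry.
    rewrite lte_fin => sy; have ys : 0 < y - s by rewrite subr_gt0.
    have [n _ /(_ _ (leqnn n))] := near_infty_natSinv_lt (PosNum ys).
    by exists n; rewrite lte_fin -ltrBrDl.
  by split => //=; apply: lt_trans ng; rewrite lte_fin ltrDl.
have cvgF : leb2 (F n) @[n --> \oo] --> distr_fun Omega g s.
  rewrite /distr_fun FE; apply: nondecreasing_cvg_mu => //.
    exact: bigcupT_measurable.
  move=> a b ab; apply/subsetPset => x [Ox /= ag]; split => //=.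
  apply: le_lt_trans ag; rewrite lee_fin lerD2l lef_pV2 ?posrE// ler_nat.
  by rewrite ltnS.
move: ms; rewrite ltNge => /negP; apply.
rewrite -(cvg_lim _ cvgF)//; apply: lime_le.
  by apply/cvg_ex; eexists; exact: cvgF.
by apply: nearW => n; apply: le_m; rewrite ltrDl.
Qed.

(** g^# is a generalised inverse of mu_g, and this is the adjunction between them. An infimum
    exceeds s strictly only with a margin t > s, which [distr_fun_right] supplies. *)
Lemma rearr_gt (R : realType) (Omega : set (R * R)) (g : R * R -> \bar R)
    (x : R * R) (s : R) : measurable Omega -> measurable_fun Omega g ->
  0 <= s ->
  (s%:E < rearr Omega g x)%E =
  (leb2 (disc (enorm x)%:E `&` Omega) < distr_fun Omega g s)%E.
Proof.
move=> mO mg s0; apply/idP/idP => h.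
  rewrite ltNge; apply/negP => gs; move: h; rewrite ltNge => /negP; apply.
  by apply: ereal_inf_lbound; exists s.
have [t st tg] := distr_fun_right mO mg h.
apply: (@lt_le_trans _ _ t%:E); first by rewrite lte_fin.
apply/ereal_infP => _ [u [u0 um] <-]; rewrite lee_fin leNgt; apply/negP.
move=> /ltW /(distr_funS mO mg) => tu.
by move: (lt_le_trans tg tu); rewrite ltNge um.
Qed.

Lemma rearr_ge0 (R : realType) (Omega : set (R * R)) (g : R * R -> \bar R)
  (x : R * R) : (0 <= rearr Omega g x)%E.
Proof. by apply/ereal_infP => _ [u [u0 _] <-]; rewrite lee_fin. Qed.

(* The level sets of a rearrangement are cut out by discs, and have the same
   area as those of the function. *)
Lemma rearr_level (R : realType) (Omega : set (R * R)) (g : R * R -> \bar R)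
    (s : R) : measurable Omega -> measurable_fun Omega g -> 0 <= s ->
  measurable (Omega `&` [set x | (s%:E < rearr Omega g x)%E]) /\
  leb2 (Omega `&` [set x | (s%:E < rearr Omega g x)%E]) = distr_fun Omega g s.
Proof.
move=> mO mg s0.
have [mw w0 _ muw] := disc_volume_coordinate (ltry (0 : R)).
have discy : disc (+oo : \bar R)%E = [set: R * R].
  by apply/seteqP; split => // x _; rewrite /disc/= ltry.
rewrite discy in mw w0 muw.
have {}muw (t : R) : 0 <= t -> leb2 [set x : R * R | pi * enorm x ^+ 2 < t] = t%:E.
  by move=> t0; rewrite -[X in leb2 X]setTI muw// setT_area leey.
have gO : (0 <= distr_fun Omega g s <= leb2 Omega)%E.
  rewrite measure_ge0/=; apply: le_measure; rewrite ?inE//.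
  exact: emeasurable_fun_o_infty.
(* By [rearr_gt] the level set consists of the x in Omega whose disc meets Omega in area less than r
   = mu_g(s); [volume_level] turns it into a sublevel set of |x| in Omega, of area exactly r. *)
have [c cE cg] := volume_level (mu := leb2) mO mw (fun x => w0 x I) muw gO.
suff -> : Omega `&` [set x | (s%:E < rearr Omega g x)%E] =
    Omega `&` [set x | ((pi * enorm x ^+ 2)%:E < c)%E].
  split => //.
  apply: emeasurable_fun_infty_o => //.
  by apply/measurable_EFinP; exact: measurable_funTS.
have discE (x : R * R) : disc (enorm x)%:E `&` Omega =
    Omega `&` [set y | pi * enorm y ^+ 2 < pi * enorm x ^+ 2].
  rewrite setIC; apply/seteqP; split => y [Oy] /=; rewrite /disc/= lte_fin;
    by rewrite ltr_pM2l ?pi_gt0// ltr_pXn2r// nnegrE enorm_ge0.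
by rewrite -cE; apply/seteqP; split => x [Ox] /=; rewrite rearr_gt// discE.
Qed.

Lemma measurable_rearr (R : realType) (Omega : set (R * R))
    (g : R * R -> \bar R) : measurable Omega -> measurable_fun Omega g ->
  measurable_fun Omega (rearr Omega g).
Proof.
move=> mO mg _; apply: (measurability _ (ErealGenOInfty.measurableE R)) => //.
move=> _ [_ [s ->] <-]; have [s0|s0] := leP 0 s.
  have [+ _] := rearr_level mO mg s0.
  by congr (measurable (_ `&` _)); apply/seteqP; split => x /=;
    rewrite in_itv/= andbT.
rewrite setIidl// => x _ /=; rewrite in_itv/= andbT.
by apply: lt_le_trans (rearr_ge0 _ _ _); rewrite lte_fin.
Qed.

(* A name for the Lebesgue measure of the plane to carry its sigma-finite
   structure, which is not inferred for products of sigma-finite measures. *)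
Definition area (R : realType) :=
  @product_measure1 _ _ _ _ R lebesgue_measure lebesgue_measure.

HB.instance Definition _ (R : realType) := Measure.on (@area R).

Lemma area_sigma_finite (R : realType) : sigma_finite [set: R * R] (@area R).
Proof.
exists (fun n : nat => disc (n%:R : R)%:E).
  apply/seteqP; split => // x _; exists (Num.bound (enorm x)) => //.
  by rewrite /disc/= lte_fin archi_boundP// enorm_ge0.
move=> n; split; first exact: measurable_disc.
by rewrite /area disc_area// ltry.
Qed.

HB.instance Definition _ (R : realType) :=
  Measure_isSigmaFinite.Build _ _ _ (@area R) (@area_sigma_finite R).

(** * Norms, distribution functions and [beta] as integrals *)

Lemma norm_on1 (R : realType) (Omega : set (R * R)) (f : R * R -> \bar R) :
  norm_on Omega 1 f = (\int[leb2]_(x in Omega) `|f x|)%E.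
Proof.
rewrite /norm_on Lnorm1 [RHS]integral_mkcond; apply: eq_integral => x _.
by rewrite !patchE; case: ifPn => // _; rewrite abse0.
Qed.

Lemma norm_on_oo (R : realType) (Omega : set (R * R)) (q : R * R -> R) :
  (norm_on Omega +oo (EFin \o q) < +oo)%E ->
  exists K : R, [/\ 0 <= K, norm_on Omega +oo (EFin \o q) = K%:E
    & {ae leb2, forall x, Omega x -> q x <= K}].
Proof.
move=> qoo.
have q0 : (0 <= norm_on Omega +oo (EFin \o q))%E by exact: Lnorm_ge0.
have qfin : norm_on Omega +oo (EFin \o q) \is a fin_num by rewrite ge0_fin_numE.
exists (fine (norm_on Omega +oo (EFin \o q))); split.
- exact: fine_ge0.
- by rewrite fineK.
(* [Lnorm] at +oo is an essential supremum only if the whole space has positive measure. *)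
have h : (leb2 [set: R * R] > 0)%E by rewrite setT_area.
have : (ess_sup leb2 (abse \o (EFin \o q \_ Omega)) <=
    (fine (norm_on Omega +oo (EFin \o q)))%:E)%E.
  rewrite fineK// /norm_on unlock; case: ifPn => [_|/negP//].
  by rewrite restrict_EFin.
move=> /ess_supP; apply: filterS => x /= + Ox.
by rewrite patchE mem_set// lee_fin; apply: le_trans; exact: ler_norm.
Qed.

(** The layer-cake formula. With the equality of distribution functions it gives [om t] and [om_in]
    the same L^1 norm. *)
Lemma integral_max0_distr (R : realType) (Omega : set (R * R))
    (f : R * R -> R) : measurable Omega -> measurable_fun Omega f ->
  measurable_fun (`]0, +oo[ : set R) (distr_fun Omega (EFin \o f)) /\
  (\int[leb2]_(x in Omega) (Num.max 0 (f x))%:E =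
   \int[lebesgue_measure]_(s in `]0%R, +oo[) distr_fun Omega (EFin \o f) s)%E.
Proof.
move=> mO mf.
have [m e] := measure_positive_layers (@area R) mO (measurable_cst (0 : R))
  (fun _ _ => lexx 0) mf.
have layerE s : 0 < s -> area (Omega `&` [set x | cst 0 x <= s < f x]) =
    distr_fun Omega (EFin \o f) s.
  move=> s0; congr (leb2 (_ `&` _)); apply/seteqP; split => x /=.
    by rewrite lte_fin => /andP[].
  by rewrite lte_fin => ->; rewrite ltW.
split.
  apply: eq_measurable_fun m => s; rewrite inE/= in_itv/= andbT => s0.
  exact: layerE.
apply: (@etrans _ _ (\int[area (R:=R)]_(x in Omega)
    (Num.max 0 (f x - cst 0 x)%R)%:E)%E).
  by apply: eq_integral => x _; rewrite /= subr0.
apply: etrans (esym e) _.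
apply: eq_integral => s; rewrite inE/= in_itv/= andbT => s0; exact: layerE.
Qed.

Lemma measurable_beta (R : realType) (Omega : set (R * R))
    (g h : R * R -> \bar R) : measurable Omega ->
  measurable_fun Omega g -> measurable_fun Omega h ->
  measurable_fun (`[0, +oo[ : set R) (beta Omega g h) /\
  (\int[lebesgue_measure]_(s in `[0%R, +oo[) beta Omega g h s =
   \int[leb2]_(x in Omega) lebesgue_measure
      [set s : R | [/\ (0 <= s)%R, (g x <= s%:E)%E & (s%:E < h x)%E]])%E.
Proof.
move=> mO mg mh.
have [m1 e1] := fubini_layers (w := cst (1 : R)) (@area R) mO (measurable_cst _)
  (fun _ _ => ler01) mg mh.
have betaE s : (\int[leb2]_(x in Omega `&` [set x | (g x <= s%:E < h x)%E]) 1%:E =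
    beta Omega g h s)%E.
  transitivity (1 * leb2 (Omega `&` [set x | (g x <= s%:E < h x)%E]))%E.
    by apply: integral_cst; exact: measurable_layer.
  rewrite mul1e; congr (leb2 (_ `&` _)).
  by apply/seteqP; split => x /= /andP.
split; first by apply: eq_measurable_fun m1 => s _; exact: betaE.
apply: etrans; last first.
  by apply: etrans e1 _; apply: eq_integral => x _; rewrite mul1e.
by apply: eq_integral => s _; exact/esym/betaE.
Qed.

(** The layer has length (b - a)^+ for finite a and b. If a = +oo it is empty, which settles the
    case where a - b is an indeterminate difference. *)
Lemma lebesgue_layer_le (R : realType) (a b : \bar R) : (0 <= a)%E ->
  (lebesgue_measure [set s : R | [/\ (0 <= s)%R, (a <= s%:E)%E & (s%:E < b)%E]]
   <= `|a - b|)%E.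
Proof.
move=> a0; case: a a0 => [a| |//] a0; last first.
  rewrite (_ : mkset _ = set0) ?measure0//.
  by apply/seteqP; split => // s [_]; rewrite leye_eq.
case: b => [b| |]; last 2 first.
- by rewrite leey.
- rewrite (_ : mkset _ = set0) ?measure0//.
  by apply/seteqP; split => // s [_ _]; rewrite ltNge leNye.
rewrite lebesgue_measure_layer -?lee_fin// -EFinB lee_fin ge_max normr_ge0/=.
by rewrite distrC ler_norm.
Qed.

(** By Tonelli the left-hand side integrates the lengths bounded in [lebesgue_layer_le]. Together
    with mu_q <= |Supp q| it turns the first inequality for a steady state into the second. *)
Lemma integral_beta_le (R : realType) (Omega : set (R * R))
    (g h : R * R -> \bar R) : measurable Omega ->
  measurable_fun Omega g -> (forall x, 0 <= g x)%E -> measurable_fun Omega h ->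
  (\int[lebesgue_measure]_(s in `[0%R, +oo[) beta Omega g h s <=
   norm_on Omega 1 (fun x => g x - h x)%E)%E.
Proof.
move=> mO mg g0 mh; have [_ ->] := measurable_beta mO mg mh.
rewrite norm_on1; apply: ge0_le_integral => //.
- have mx := measurable_fun_xsection (@lebesgue_measure R)
    (measurable_layers mO mg mh).
  apply: (eq_measurable_fun _ _ (measurable_funTS mx)) => x /set_mem Ox.
  rewrite /=; congr (lebesgue_measure _); apply/seteqP; split => s.
    by move/xsectionP => -[].
  by move=> [s0 gs sh]; apply/xsectionP.
- by apply: measurableT_comp => //; exact: emeasurable_funB.
- by move=> x _; exact: lebesgue_layer_le.
Qed.

(** * Stability of steady states *)

Lemma adde_def_sub_ge0 (R : realDomainType) (a b y : \bar R) :
  (0 <= a)%E -> b \is a fin_num -> (0 <= y)%E -> (a - b +? y)%E.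
Proof. by case: a => [a| |]//; case: b => [b| |]//; case: y. Qed.

Lemma ae_max0 (R : realType) (Omega : set (R * R)) (f : R * R -> R) :
  {ae leb2, forall x, Omega x -> 0 <= f x} ->
  {ae leb2, forall x, Omega x -> f x = Num.max 0 (f x)}.
Proof.
apply: filterS; first exact: (ae_filter_ringOfSetsType (@area R)).
by move=> x f0 /f0 fx; rewrite max_r.
Qed.

(** A solution is nonnegative only almost everywhere, whereas [volume_coordinate_stability] asks for
    it on the whole domain. [F x y] is the integrand as a function of the value y of f, so that
    norms and moments are covered alike. *)
Lemma integral_ae_max0 (R : realType) (Omega : set (R * R)) (f : R * R -> R)
    (F : R * R -> R -> \bar R) : measurable Omega ->
  measurable_fun Omega (fun x => F x (f x)) ->
  measurable_fun Omega (fun x => F x (Num.max 0 (f x))) ->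
  {ae leb2, forall x, Omega x -> 0 <= f x} ->
  (\int[leb2]_(x in Omega) F x (f x) =
   \int[leb2]_(x in Omega) F x (Num.max 0 (f x))%R)%E.
Proof.
move=> mO m1 m2 /ae_max0 f0; apply: ae_eq_integral => //.
apply: filterS f0; first exact: (ae_filter_ringOfSetsType (@area R)).
by move=> x h /h {1}->.
Qed.

Lemma distr_fun_max0 (R : realType) (Omega : set (R * R)) (f : R * R -> R) (s : R) :
  0 <= s -> distr_fun Omega (EFin \o (fun x => Num.max 0 (f x))) s =
            distr_fun Omega (EFin \o f) s.
Proof.
move=> s0; congr (leb2 (_ `&` _)); apply/seteqP; split => x /=;
  by rewrite !lte_fin lt_max ltNge s0.
Qed.

Lemma eq_rearr_distr (R : realType) (Omega : set (R * R))
    (f g : R * R -> \bar R) (s : R) : measurable Omega ->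
  measurable_fun Omega f -> measurable_fun Omega g -> 0 <= s ->
  (forall x, Omega x -> rearr Omega f x = rearr Omega g x) ->
  distr_fun Omega f s = distr_fun Omega g s.
Proof.
move=> mO mf mg s0 fg.
have e : Omega `&` [set x | (s%:E < rearr Omega f x)%E] =
    Omega `&` [set x | (s%:E < rearr Omega g x)%E].
  by apply/seteqP; split => x [Ox]; rewrite /= (fg _ Ox) => h; exact: conj.
apply: etrans (esym (rearr_level mO mf s0).2) _.
apply: etrans (f_equal (@area R) e) _.
exact: (rearr_level mO mg s0).2.
Qed.

Lemma distr_fun_le_add_beta (R : realType) (Omega : set (R * R))
    (g h : R * R -> \bar R) (s : R) : measurable Omega ->
  measurable_fun Omega g -> measurable_fun Omega h ->
  (distr_fun Omega h s <= distr_fun Omega g s + beta Omega g h s)%E.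
Proof.
move=> mO mg mh.
have mgs := emeasurable_fun_o_infty mO mg s%:E.
have mhs := emeasurable_fun_o_infty mO mh s%:E.
have mb : measurable (Omega `&` [set x | (g x <= s%:E)%E /\ (s%:E < h x)%E]).
  rewrite (_ : _ `&` _ = Omega `&` [set x | (g x <= s%:E < h x)%E]).
    exact: measurable_layer.
  by congr (_ `&` _); apply/seteqP; split => x /= /andP.
apply: le_trans (measureU2 (@area R) mgs mb).
apply: (le_measure (@area R)); rewrite ?inE; [exact: mhs|exact: measurableU|].
move=> x [Ox /= sh]; have [gx|sg] := leP (g x) s%:E; first by right; split.
by left; split.
Qed.

(** A function and its rearrangement have the same distribution function, so level sets of the
    rearrangements can be compared instead. This provides the majorant [bs] of
    [volume_coordinate_stability]. *)
Lemma distr_fun_le_beta (R : realType) (Omega : set (R * R))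
    (g h : R * R -> \bar R) (s : R) : measurable Omega ->
  measurable_fun Omega g -> measurable_fun Omega h -> 0 <= s ->
  (distr_fun Omega h s <= distr_fun Omega g s +
     beta Omega (rearr Omega g) (rearr Omega h) s)%E.
Proof.
move=> mO mg mh s0.
rewrite -(rearr_level mO mg s0).2 -(rearr_level mO mh s0).2.
exact: (distr_fun_le_add_beta s mO (measurable_rearr mO mg)
  (measurable_rearr mO mh)).
Qed.

Lemma beta_ge0 (R : realType) (Omega : set (R * R)) (g h : R * R -> \bar R)
  (s : R) : (0 <= beta Omega g h s)%E.
Proof. exact: measure_ge0. Qed.

Lemma distr_fun_Supp (R : realType) (Omega : set (R * R)) (q : R * R -> R)
    (s : R) : measurable Omega -> measurable_fun Omega q -> 0 <= s ->
  (distr_fun Omega (EFin \o q) s <= leb2 (Supp Omega q))%E.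
Proof.
move=> mO mq s0; apply: le_measure; rewrite ?inE.
- by apply: emeasurable_fun_o_infty => //; exact/measurable_EFinP.
- by apply: closed_measurable2; exact: closed_closure.
- move=> x [Ox /=]; rewrite lte_fin => sq; apply: subset_closure; split => //.
  by rewrite gt_eqF// (le_lt_trans s0 sq).
Qed.

(** For the coordinate w = c wt the abstract bound is 4 K (c X + 2 M), with X the momentum
    difference, M the integral of mu_q beta and K the sup norm of q. Factoring out c gives 4 c K (X
    + (2 / c) M), with c = pi on a disc and c = L1 on a rectangle. *)
Theorem steady_state_stability (R : realType) (Omega : set (R * R))
    (bc : (R * R -> R) -> (R * R -> R) -> (R * R -> R * R) -> Prop)
    (wt : R * R -> R) (c : R) (om_in : R * R -> R) (om : R -> R * R -> R)
    (q : R * R -> R) :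
  measurable Omega -> 0 < c ->
  volume_coordinate leb2 Omega (fun x => c * wt x) ->
  inL1 Omega om_in ->
  {ae leb2, forall x, Omega x -> 0 <= om_in x} ->
  global_weak_solution Omega bc wt om_in om ->
  inL1 Omega q ->
  (norm_on Omega +oo (EFin \o q) < +oo)%E ->
  (forall x, Omega x -> 0 <= q x) ->
  (forall x y, Omega x -> Omega y -> wt x <= wt y -> q y <= q x) ->
  (\int[leb2]_(x in Omega) (wt x * q x)%:E < +oo)%E ->
  (forall t, 0 <= t ->
    ((norm_on Omega 1 (fun x => (om t x - q x)%:E)
        + norm_on Omega 1 (EFin \o q)
        - norm_on Omega 1 (EFin \o om_in)) ^+ 2
     <= (4 * c)%:E * norm_on Omega +oo (EFin \o q) *
        (\int[leb2]_(x in Omega) (wt x * (om_in x - q x))%:E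
         + (2 / c)%:E *
           \int[lebesgue_measure]_(s in `[0%R, +oo[)
             (distr_fun Omega (EFin \o q) s *
              beta Omega (rearr Omega (EFin \o om_in))
                         (rearr Omega (EFin \o q)) s)))%E) /\
  (compact (Supp Omega q) -> forall t, 0 <= t ->
    ((norm_on Omega 1 (fun x => (om t x - q x)%:E)
        + norm_on Omega 1 (EFin \o q)
        - norm_on Omega 1 (EFin \o om_in)) ^+ 2
     <= (4 * c)%:E * norm_on Omega +oo (EFin \o q) *
        (\int[leb2]_(x in Omega) (wt x * (om_in x - q x))%:E
         + (2 / c)%:E * leb2 (Supp Omega q) *
           norm_on Omega 1 (fun x => rearr Omega (EFin \o om_in) x
                                     - rearr Omega (EFin \o q) x)))%E).
Proof.
move=> mO c0 vw hi hi0 sol qi qoo q0 qw wq.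
have [mcw cw0 _ _] := vw.
have w0 x : Omega x -> 0 <= wt x by move=> /cw0; rewrite pmulr_rge0.
have mw : measurable_fun Omega wt.
  have -> : wt = (fun x => c^-1 * (c * wt x)).
    by apply/funext => x; rewrite mulKf// gt_eqF.
  exact: measurable_funM.
have mh : measurable_fun Omega om_in.
  by apply/measurable_EFinP; have /integrableP[] := hi.
have mq : measurable_fun Omega q.
  by apply/measurable_EFinP; have /integrableP[] := qi.
have meh : measurable_fun Omega (EFin \o om_in) by exact/measurable_EFinP.
have meq : measurable_fun Omega (EFin \o q) by exact/measurable_EFinP.
have mrh := measurable_rearr mO meh; have mrq := measurable_rearr mO meq.
pose bs := beta Omega (rearr Omega (EFin \o om_in)) (rearr Omega (EFin \o q)).
have [mbs _] := measurable_beta mO mrh mrq.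
have mdq : measurable_fun (`[0, +oo[ : set R) (distr_fun Omega (EFin \o q)).
  apply/emeasurable_fun_itv_obnd_cbndP.
  exact: (integral_max0_distr mO mq).1.
have ineq1 t : 0 <= t ->
    ((norm_on Omega 1 (fun x => (om t x - q x)%:E)
        + norm_on Omega 1 (EFin \o q)
        - norm_on Omega 1 (EFin \o om_in)) ^+ 2
     <= (4 * c)%:E * norm_on Omega +oo (EFin \o q) *
        (\int[leb2]_(x in Omega) (wt x * (om_in x - q x))%:E
         + (2 / c)%:E *
           \int[lebesgue_measure]_(s in `[0%R, +oo[)
             (distr_fun Omega (EFin \o q) s * bs s)))%E.
  move=> t0.
  pose f x := Num.max 0 (om t x).
  have omi : inL1 Omega (om t) by exact: (sol_L1 sol).
  have om0 : {ae leb2, forall x, Omega x -> 0 <= om t x}.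
    exact: (sol_ge0 sol).
  have mom : measurable_fun Omega (om t).
    by apply/measurable_EFinP; have /integrableP[] := omi.
  have meom : measurable_fun Omega (EFin \o om t) by exact/measurable_EFinP.
  have mf : measurable_fun Omega f by exact: measurable_maxr.
  have f0 x : 0 <= f x by rewrite le_max lexx.
  have fi : inL1 Omega f.
    apply: le_integrable omi => //; first exact/measurable_EFinP.
    move=> x _; rewrite lee_fin ger0_norm// ge_max normr_ge0/=.
    exact: ler_norm.
  have distrE s : 0 <= s -> distr_fun Omega (EFin \o om_in) s =
      distr_fun Omega (EFin \o om t) s.
    move=> s0; apply: (eq_rearr_distr mO meh meom s0) => x Ox.
    exact: (esym (sol_rearr sol t0 Ox)).
  have N1 : norm_on Omega 1 (fun x => (om t x - q x)%:E) =
      (\int[leb2]_(x in Omega) `|f x - q x|%:E)%E.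
    rewrite norm_on1.
    apply: (integral_ae_max0 (F := fun x y => `|(y - q x)%:E|%E)) => //.
    - apply: measurableT_comp => //; apply/measurable_EFinP.
      exact: measurable_funB.
    - apply: measurableT_comp => //; apply/measurable_EFinP.
      exact: measurable_funB.
  have N2 : norm_on Omega 1 (EFin \o q) = (\int[leb2]_(x in Omega) (q x)%:E)%E.
    rewrite norm_on1; apply: eq_integral => x /set_mem Ox.
    by rewrite /= ger0_norm// q0.
  have N3 : norm_on Omega 1 (EFin \o om_in) =
      (\int[leb2]_(x in Omega) (f x)%:E)%E.
    rewrite norm_on1.
    transitivity (\int[leb2]_(x in Omega) `|(Num.max 0 (om_in x))%:E|)%E.
      apply: (integral_ae_max0 (F := fun x y => `|y%:E|%E)) => //.
      - exact: measurableT_comp.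
      - apply: measurableT_comp => //; apply/measurable_EFinP.
        exact: measurable_maxr.
    transitivity (\int[leb2]_(x in Omega) (Num.max 0 (om_in x))%:E)%E.
      by apply: eq_integral => x _; rewrite gee0_abs// lee_fin le_max lexx.
    rewrite (integral_max0_distr mO mh).2 (integral_max0_distr mO mom).2.
    apply: eq_integral => s; rewrite inE/= in_itv/= andbT => s0.
    by rewrite distrE// ltW.
  have [K [K0 qK qKae]] := norm_on_oo qoo.
  have mbs' : measurable_fun (`]0, +oo[ : set R) bs.
    by apply/emeasurable_fun_itv_obnd_cbndP; exact: mbs.
  have hbs s : 0 < s ->
      (area (Omega `&` [set x | (s%:E < (q x)%:E)%E]) <=
       area (Omega `&` [set x | (s%:E < (f x)%:E)%E]) + bs s)%E.
    move=> s0; have h := distr_fun_le_beta mO meh meq (ltW s0).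
    rewrite (distrE _ (ltW s0)) -(distr_fun_max0 Omega (om t) (ltW s0)) in h.
    exact: h.
  have cwq : (\int[area (R:=R)]_(x in Omega) (c * wt x * q x)%:E < +oo)%E.
    under eq_integral do rewrite -mulrA EFinM.
    rewrite ge0_integralZl_EFin//.
    - by rewrite lte_mul_pinfty ?lee_fin// ltW.
    - by move=> x Ox; rewrite lee_fin mulr_ge0 ?w0 ?q0.
    - by apply/measurable_EFinP; exact: measurable_funM.
    - exact: ltW.
  have cqw x y : Omega x -> Omega y -> c * wt x <= c * wt y -> q y <= q x.
    by move=> Ox Oy; rewrite ler_pM2l//; exact: qw.
  have main := @volume_coordinate_stability _ _ R (area (R:=R)) Omega
    (fun x => c * wt x) f q K bs mO vw fi (fun x _ => f0 x) qi q0 cqw K0 qKae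
    cwq mbs' (fun s => beta_ge0 _ _ _ s) hbs.
  rewrite N1 N2 N3 qK; apply: le_trans main _.
  set M := (\int[lebesgue_measure]_(s in `[0%R, +oo[) (_ * _))%E.
  have M0 : (0 <= M)%E.
    by apply: integral_ge0 => s _; rewrite mule_ge0 ?measure_ge0 ?beta_ge0.
  have ME : (\int[lebesgue_measure]_(s in `]0%R, +oo[)
      (area (Omega `&` [set x | (s%:E < (q x)%:E)%E]) * bs s))%E = M.
    apply: integral_itv_obnd_cbnd; apply: emeasurable_funM mbs'.
    exact: (integral_max0_distr mO mq).1.
  have wmax (g : R * R -> R) : measurable_fun Omega g ->
      {ae leb2, forall x, Omega x -> 0 <= g x} ->
      (\int[leb2]_(x in Omega) (wt x * g x)%:E =
       \int[leb2]_(x in Omega) (wt x * Num.max 0 (g x))%:E)%E.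
    move=> mg g0.
    apply: (integral_ae_max0 (F := fun x y => (wt x * y)%:E)) => //.
      by apply/measurable_EFinP; exact: measurable_funM.
    apply/measurable_EFinP; apply: measurable_funM => //.
    exact: measurable_maxr.
  have mh' : measurable_fun Omega (fun x => Num.max 0 (om_in x)).
    exact: measurable_maxr.
  have h'0 x : Omega x -> 0 <= Num.max 0 (om_in x) by rewrite le_max lexx.
  set A := (\int[leb2]_(x in Omega) (wt x * f x)%:E)%E.
  set Q := (\int[leb2]_(x in Omega) (wt x * q x)%:E)%E in wq.
  have A0 : (0 <= A)%E.
    by apply: integral_ge0 => x Ox; rewrite lee_fin mulr_ge0 ?w0.
  have Qfin : Q \is a fin_num.
    rewrite ge0_fin_numE//; apply: integral_ge0 => x Ox.
    by rewrite lee_fin mulr_ge0 ?w0 ?q0.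
  (* [A] is the momentum at time t, equal to that of [om_in] by conservation; it may be +oo, but [Q]
     is finite. *)
  have XE : (\int[leb2]_(x in Omega) (wt x * (om_in x - q x))%:E = A - Q)%E.
    transitivity (\int[leb2]_(x in Omega)
        (wt x * (Num.max 0 (om_in x) - q x))%:E)%E.
      apply: (integral_ae_max0 (F := fun x y => (wt x * (y - q x))%:E)) => //.
        apply/measurable_EFinP; apply: measurable_funM => //.
        exact: measurable_funB.
      apply/measurable_EFinP; apply: measurable_funM => //.
      exact: measurable_funB.
    apply: etrans (integral_weighted_subE (mu := area (R:=R)) mO mw w0 mh' h'0
      mq q0 wq).1 _.
    congr (_ - _)%E.
    apply: etrans (esym (wmax _ mh hi0)) _.
    apply: etrans (esym (sol_momentum sol t0)) _.
    exact: wmax mom om0.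
  have cXE : (\int[area (R:=R)]_(x in Omega) (c * wt x * (f x - q x))%:E =
      c%:E * A - c%:E * Q)%E.
    apply: etrans (integral_weighted_subE (mu := area (R:=R)) mO mcw cw0 mf
      (fun x _ => f0 x) mq q0 cwq).1 _.
    congr (_ - _)%E.
      under eq_integral do rewrite -mulrA EFinM.
      rewrite ge0_integralZl_EFin ?ltW//.
      - by move=> x Ox; rewrite lee_fin mulr_ge0 ?w0.
      - by apply/measurable_EFinP; exact: measurable_funM.
    under eq_integral do rewrite -mulrA EFinM.
    rewrite ge0_integralZl_EFin ?ltW//.
    - by move=> x Ox; rewrite lee_fin mulr_ge0 ?w0 ?q0.
    - by apply/measurable_EFinP; exact: measurable_funM.
  rewrite ME cXE XE; move: A0 M0 Qfin; clearbody A M Q => A0 M0 Qfin.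
  have -> : (c%:E * A - c%:E * Q + 2%:E * M =
      c%:E * (A - Q + (2 / c)%:E * M))%E.
    have cM0 : (0 <= (2 / c)%:E * M)%E.
      by rewrite mule_ge0// lee_fin divr_ge0// ltW.
    (* [A] and [M] are nonnegative and [Q] is finite, so A - Q and M are never infinities of
       opposite signs and c distributes. *)
    rewrite muleDr//; last exact: adde_def_sub_ge0.
    rewrite muleA -EFinM mulrC divfK ?gt_eqF//.
    by rewrite muleBr// fin_num_adde_defl// fin_numN.
  by rewrite muleA -!EFinM (mulrAC 4).
split=> // cS t t0; apply: le_trans (ineq1 t t0) _.
apply: lee_wpmul2l; first by rewrite mule_ge0 ?Lnorm_ge0// lee_fin mulr_ge0// ltW.
apply: leeD2l; rewrite -muleA; apply: lee_wpmul2l.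
  by rewrite lee_fin divr_ge0// ltW.
apply: (@le_trans _ _ (\int[lebesgue_measure]_(s in `[0%R, +oo[)
    (leb2 (Supp Omega q) * bs s))%E).
  apply: ge0_le_integral => //.
  - by move=> s _; rewrite mule_ge0 ?measure_ge0 ?beta_ge0.
  - exact: emeasurable_funM.
  - exact: measurable_funeM.
  - move=> s; rewrite /= in_itv/= andbT => s0.
    by rewrite lee_pmul ?measure_ge0 ?beta_ge0// distr_fun_Supp.
rewrite ge0_integralZl; [|exact: measurable_itv|exact: mbs
  |by move=> s _; exact: beta_ge0|exact: measure_ge0].
apply: lee_wpmul2l; first exact: measure_ge0.
by apply: integral_beta_le => // x; exact: rearr_ge0.
Qed.

(** Integrating first in x.2 gives the one-dimensional moment [I] when 0 < x.1 < L1 and 0 otherwise,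
    so the moment of q is [I] times the length of ]0, L1[. *)
Lemma rect_moment_lty (R : realType) (L1 : R) (L2 : \bar R) (q : R * R -> R)
    (F : R -> R) : (0 < L2)%E ->
  measurable_fun (rect L1 L2) q -> (forall x, rect L1 L2 x -> q x = F x.2) ->
  (forall r, 0 < r -> (r%:E < L2)%E -> 0 <= F r) ->
  (\int[lebesgue_measure]_(y in [set y : R | (0 < y)%R /\ (y%:E < L2)%E])
     (y * F y)%:E < +oo)%E ->
  (\int[leb2]_(x in rect L1 L2) (x.2 * q x)%:E < +oo)%E.
Proof.
move=> L20 mq qF F0; set I := (\int[_]_(y in _) _)%E => Ioo.
have I0 : (0 <= I)%E.
  by apply: integral_ge0 => y [y0 yL]; rewrite lee_fin mulr_ge0 ?F0// ltW.
have mO := measurable_rect L1 L20.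
pose H := (fun x : R * R => (x.2 * q x)%:E) \_ (rect L1 L2).
have mH : measurable_fun [set: R * R] H.
  apply/(measurable_restrictT _ mO)/measurable_EFinP.
  by apply: measurable_funM => //; apply: measurable_funTS; exact: measurable_snd.
have H0 x : (0 <= H x)%E.
  rewrite /H patchE; case: ifPn => // /set_mem Ox.
  have [_ _ x0 xL] := Ox.
  by rewrite lee_fin qF// mulr_ge0 ?F0// ltW.
rewrite integral_mkcond.
have -> : (\int[leb2]_x H x = \int[lebesgue_measure]_x
    \int[lebesgue_measure]_y H (x, y))%E.
  exact: (fubini_tonelli1 (m1 := lebesgue_measure) (m2 := lebesgue_measure)).
have inner x : (\int[lebesgue_measure]_y H (x, y) =
    ((cst I) \_ (`]0%R, L1[ : set R)) x)%E.
  rewrite patchE; case: ifPn => xL.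
    rewrite /I [RHS]integral_mkcond; apply: eq_integral => y _.
    rewrite /H !patchE; move: xL; rewrite inE/= in_itv/= => /andP[x0 xL].
    have [yL|yL] := pselect ((0 < y) /\ (y%:E < L2)%E).
      rewrite !mem_set//; last by case: yL.
      by rewrite qF//; case: yL.
    by rewrite !memNset// => -[/= _ _ y0 yL2]; apply: yL.
  apply: integral0_eq => y _; rewrite /H patchE memNset// => -[/= x0 xL1 _ _].
  by move/negP: xL; apply; rewrite inE/= in_itv/= x0.
under eq_integral do rewrite inner.
rewrite -integral_mkcond integral_cst//.
have h : (lebesgue_measure (`]0%R, L1[ : set R) < +oo)%E.
  by rewrite lebesgue_measure_itv/= lte_fin; case: ifPn => _; rewrite ?ltry.
by apply: lte_mul_pinfty => //; rewrite ge0_fin_numE.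
Qed.

Theorem theorem3 (R : realType) :
  (* radial steady states *)
  (forall (rad : \bar R) (om_in : R * R -> R) (om : R -> R * R -> R)
      (q : R * R -> R) (G : R -> R),
    let Omega := disc rad in
    (0 < rad)%E ->
    inL1 Omega om_in ->
    {ae leb2, forall x, Omega x -> 0 <= om_in x} ->
    euler_disc rad om_in om ->
    inL1 Omega q ->
    (norm_on Omega +oo (EFin \o q) < +oo)%E ->
    (forall x, Omega x -> q x = G (enorm x)) ->
    (forall r, 0 <= r -> (r%:E < rad)%E -> 0 <= G r) ->
    (forall r s, 0 <= r -> r <= s -> (s%:E < rad)%E -> G s <= G r) ->
    (\int[leb2]_(x in Omega) (enorm x ^+ 2 * G (enorm x))%:E < +oo)%E ->
    (forall t, 0 <= t ->
      ((norm_on Omega 1 (fun x => (om t x - q x)%:E)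
          + norm_on Omega 1 (EFin \o q)
          - norm_on Omega 1 (EFin \o om_in)) ^+ 2
       <= (4 * pi)%:E * norm_on Omega +oo (EFin \o q) *
          (\int[leb2]_(x in Omega) (enorm x ^+ 2 * (om_in x - q x))%:E
           + (2 / pi)%:E *
             \int[lebesgue_measure]_(s in `[0%R, +oo[)
               (distr_fun Omega (EFin \o q) s *
                beta Omega (rearr Omega (EFin \o om_in))
                           (rearr Omega (EFin \o q)) s)))%E) /\
    (compact (Supp Omega q) -> forall t, 0 <= t ->
      ((norm_on Omega 1 (fun x => (om t x - q x)%:E)
          + norm_on Omega 1 (EFin \o q)
          - norm_on Omega 1 (EFin \o om_in)) ^+ 2
       <= (4 * pi)%:E * norm_on Omega +oo (EFin \o q) *
          (\int[leb2]_(x in Omega) (enorm x ^+ 2 * (om_in x - q x))%:E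
           + (2 / pi)%:E * leb2 (Supp Omega q) *
             norm_on Omega 1 (fun x => rearr Omega (EFin \o om_in) x
                                       - rearr Omega (EFin \o q) x)))%E)) /\
  (* steady states on a rectangular domain *)
  (forall (L1 : R) (L2 : \bar R) (om_in : R * R -> R) (om : R -> R * R -> R)
      (q : R * R -> R) (F : R -> R),
    let Omega := rect L1 L2 in
    0 < L1 ->
    (0 < L2)%E ->
    inL1 Omega om_in ->
    {ae leb2, forall x, Omega x -> 0 <= om_in x} ->
    euler_rect L1 L2 om_in om ->
    inL1 Omega q ->
    (norm_on Omega +oo (EFin \o q) < +oo)%E ->
    (forall x, Omega x -> q x = F x.2) ->
    (forall r, 0 < r -> (r%:E < L2)%E -> 0 <= F r) ->
    (forall r s, 0 < r -> r <= s -> (s%:E < L2)%E -> F s <= F r) ->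
    (\int[lebesgue_measure]_(y in [set y : R | (0 < y)%R /\ (y%:E < L2)%E])
       (y * F y)%:E < +oo)%E ->
    (forall t, 0 <= t ->
      ((norm_on Omega 1 (fun x => (om t x - q x)%:E)
          + norm_on Omega 1 (EFin \o q)
          - norm_on Omega 1 (EFin \o om_in)) ^+ 2
       <= (4 * L1)%:E * norm_on Omega +oo (EFin \o q) *
          (\int[leb2]_(x in Omega) (x.2 * (om_in x - q x))%:E
           + (2 / L1)%:E *
             \int[lebesgue_measure]_(s in `[0%R, +oo[)
               (distr_fun Omega (EFin \o q) s *
                beta Omega (rearr Omega (EFin \o om_in))
                           (rearr Omega (EFin \o q)) s)))%E) /\
    (compact (Supp Omega q) -> forall t, 0 <= t ->
      ((norm_on Omega 1 (fun x => (om t x - q x)%:E)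
          + norm_on Omega 1 (EFin \o q)
          - norm_on Omega 1 (EFin \o om_in)) ^+ 2
       <= (4 * L1)%:E * norm_on Omega +oo (EFin \o q) *
          (\int[leb2]_(x in Omega) (x.2 * (om_in x - q x))%:E
           + (2 / L1)%:E * leb2 (Supp Omega q) *
             norm_on Omega 1 (fun x => rearr Omega (EFin \o om_in) x
                                       - rearr Omega (EFin \o q) x)))%E)).
Proof.
split.
  move=> rad om_in om q G Omega rad0 hi hi0 sol qi qoo qG G0 Gdecr Gint.
  apply: (steady_state_stability (wt := fun x => enorm x ^+ 2) (c := pi)
    (measurable_disc rad) (pi_gt0 R) (disc_volume_coordinate rad0) hi hi0 sol
    qi qoo).
  - by move=> x Ox; rewrite qG// G0// enorm_ge0.
  - move=> x y Ox Oy; rewrite ler_pXn2r ?nnegrE ?enorm_ge0// => xy.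
    by rewrite !qG// Gdecr// enorm_ge0.
  - apply: le_lt_trans Gint; rewrite le_eqVlt; apply/orP; left; apply/eqP.
    by apply: eq_integral => x /set_mem Ox; rewrite qG.
move=> L1 L2 om_in om q F Omega L10 L20 hi hi0 sol qi qoo qF F0 Fdecr Fint.
apply: (steady_state_stability (wt := fun x => x.2) (c := L1)
  (measurable_rect L1 L20) L10 (rect_volume_coordinate L10 L20) hi hi0 sol
  qi qoo).
- by move=> x Ox; rewrite qF//; case: Ox => _ _ x0 xL; exact: F0.
- move=> x y Ox Oy xy; rewrite !qF//.
  by case: Ox => _ _ x0 _; case: Oy => _ _ _ yL; exact: Fdecr.
- apply: (rect_moment_lty L20 _ qF F0 Fint).
  by apply/measurable_EFinP; have /integrableP[] := qi.
Qed.
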